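(* Let $G$ be an amenable, finitely generated, residually finite group and let $X$ be a locally compact, separable metric space of finite covering dimension. Let $\widetilde{\alpha}:G\curvearrowright X$ be an action of $G$ on $X$ by homeomorphisms and let $\alpha:G\to\mathrm{Aut}(C_0(X))$ be the induced action on $C_0(X)$. If $\widetilde{\alpha}$ is free and proper, then $$\dim_{\mathrm{Rok}}(\alpha)\leq\dim(X).$$
   Context: All groups are countable and discrete. $\dim(X)$ is the Lebesgue covering dimension. The induced action is $\alpha_g(f)(x)=f(\widetilde{\alpha}_g^{-1}(x))$. Elements $a,b$ of a C*-algebra are orthogonal, $a\perp b$, if $ab=ba=a^*b=b^*a=0$. A contractive completely positive (c.c.p.) map has order zero if it sends orthogonal elements to orthogonal elements. Central sequence algebra: $A_\infty:=\ell^\infty(\mathbb{N},A)/c_0(\mathbb{N},A)$, with $A$ embedded as constant sequences. For a C*-subalgebra $D\subset A$, $A_\infty\cap D'=\{x\in A_\infty: xd=dx\ \forall d\in D\}$, $\mathrm{Ann}(D,A_\infty)=\{x\in A_\infty: xd=dx=0\ \forall d\in D\}$, and $F(D,A):=(A_\infty\cap D')/\mathrm{Ann}(D,A_\infty)$, which is unital if $D$ is $\sigma$-unital. If $D$ is invariant under an action $\alpha$ of $G$ on $A$, $\widetilde{\alpha}_\infty$ denotes the induced action of $G$ on $F(D,A)$. Rokhlin dimension of an action $\alpha:G\to\mathrm{Aut}(A)$ of a residually finite group $G$: for a subgroup $H\leq G$ of finite index, $\sigma^H$ is the action of $G$ on $C(G/H)$ given by $\sigma^H_t(f)(gH)=f(t^{-1}gH)$.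 $\dim_{\mathrm{Rok}}(\alpha,H)$ is the least integer $d\ge 0$ such that for every separable $\alpha$-invariant C*-subalgebra $D\subset A$ there exist $(d+1)$ $G$-equivariant c.c.p. order zero maps $\varphi_0,\ldots,\varphi_d:(C(G/H),\sigma^H)\to(F(D,A),\widetilde{\alpha}_\infty)$ with $\sum_{\ell=0}^d\varphi_\ell(1_{C(G/H)})=1_{F(D,A)}$ (and $+\infty$ if no such $d$ exists). $\dim_{\mathrm{Rok}}(\alpha)=\sup_H\dim_{\mathrm{Rok}}(\alpha,H)$, the supremum over all finite index subgroups $H$ of $G$. *)

(* Defs.v *)
From HB Require Import structures.
From mathcomp Require Import all_boot all_order all_algebra generic_quotient monoid.
From mathcomp Require Import all_classical all_reals topology normedtype ereal.
From mathcomp Require Import lra.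
From mathcomp Require Import complex.
Set Implicit Arguments.
Unset Strict Implicit.
Unset Printing Implicit Defensive.
Import Order.TTheory GRing.Theory Num.Theory.
Import numFieldNormedType.Exports.
Local Open Scope classical_set_scope.
Local Open Scope ring_scope.
Local Open Scope complex_scope.
Local Open Scope quotient_scope.
Local Notation Re := complex.Re.
Local Notation Im := complex.Im.

(* Normed *-algebras over R[i].  MathComp rings are unital, so the product of a
   possibly non-unital algebra is a separate operation.  The C*-identity and
   completeness are kept apart: quotients are only equipped with their normed
   *-algebra structure, which is all that Rokhlin dimension refers to. *)
HB.mixin Record NormedModule_isStarAlg (R : realType) V
    & NormedModule R[i] V := {
  smul : V -> V -> V;
  star : V -> V;
  smulA : associative smul;
  smulDl : left_distributive smul +%R;
  smulDr : right_distributive smul +%R;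
  smulZl : forall (a : R[i]) x y, smul (a *: x) y = a *: smul x y;
  smulZr : forall (a : R[i]) x y, smul x (a *: y) = a *: smul x y;
  starK : involutive star;
  starD : {morph star : x y / x + y};
  starZ : forall (a : R[i]) x, star (a *: x) = conjc a *: star x;
  starM : forall x y, star (smul x y) = smul (star y) (star x);
  norm_smul : forall x y, `|smul x y| <= `|x| * `|y|;
  norm_star : forall x, `|star x| = `|x|
}.

#[short(type="normedStarAlgType")]
HB.structure Definition NormedStarAlg (R : realType) :=
  {V of NormedModule R[i] V & NormedModule_isStarAlg R V}.

HB.mixin Record NormedStarAlg_isCstar (R : realType) A & NormedStarAlg R A := {
  cstar_norm : forall x : A, `|smul (star x) x| = `|x| ^+ 2
}.

#[short(type="cstarAlgType")]
HB.structure Definition CstarAlg (R : realType) :=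
  {A of NormedStarAlg R A & Complete A & NormedStarAlg_isCstar R A}.

Notation "x ⋆ y" := (smul x y) (at level 40, left associativity) : ring_scope.

Section StarAlgTheory.
Context {R : realType} {A : normedStarAlgType R}.
Implicit Types x y : A.

Lemma smul0l x : 0 ⋆ x = 0.
Proof. by rewrite -(scale0r (0 : A)) smulZl !scale0r. Qed.
Lemma smul0r x : x ⋆ 0 = 0.
Proof. by rewrite -(scale0r (0 : A)) smulZr !scale0r. Qed.
Lemma star0 : star (0 : A) = 0.
Proof. by rewrite -(scale0r (0 : A)) starZ conjc0 !scale0r. Qed.
Lemma smulNl x y : (- x) ⋆ y = - (x ⋆ y).
Proof. by rewrite -scaleN1r smulZl scaleN1r. Qed.
Lemma smulNr x y : x ⋆ (- y) = - (x ⋆ y).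
Proof. by rewrite -scaleN1r smulZr scaleN1r. Qed.
Lemma smulBl x y z : (x - y) ⋆ z = x ⋆ z - y ⋆ z.
Proof. by rewrite smulDl smulNl. Qed.
Lemma smulBr x y z : z ⋆ (x - y) = z ⋆ x - z ⋆ y.
Proof. by rewrite smulDr smulNr. Qed.
Lemma starN x : star (- x) = - star x.
Proof. by apply/eqP; rewrite -subr_eq0 opprK -starD addNr star0. Qed.
Lemma starB x y : star (x - y) = star x - star y.
Proof. by rewrite starD starN. Qed.

End StarAlgTheory.

(* The norm of a normed module over R[i] takes its values in R[i]; rnorm is the
   same number seen in R. *)
Definition rnorm (R : realType) (V : normedModType R[i]) (x : V) : R :=
  Re (`|x| : R[i]).

Section Rnorm.
Context {R : realType} {V : normedModType R[i]}.
Implicit Types x y : V.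

Lemma rnormK x : (rnorm x)%:C = `|x|.
Proof. by rewrite /rnorm RRe_real// ger0_real. Qed.

Lemma rnorm_le x (M : R) : (`|x| <= M%:C) = (rnorm x <= M).
Proof. by rewrite -rnormK lecR. Qed.

Lemma rnorm_lt x (M : R) : (`|x| < M%:C) = (rnorm x < M).
Proof. by rewrite -rnormK ltcR. Qed.

Lemma rnorm_ge0 x : 0 <= rnorm x.
Proof. by rewrite -ler0c rnormK. Qed.

Lemma rnormD x y : rnorm (x + y) <= rnorm x + rnorm y.
Proof. by rewrite -lecR rmorphD/= !rnormK ler_normD. Qed.

Lemma rnormZ (a : R[i]) x : rnorm (a *: x) = rnorm (a : R[i]^o) * rnorm x.
Proof. by apply: complexI; rewrite rmorphM/= !rnormK normrZ. Qed.

Lemma rnormN x : rnorm (- x) = rnorm x.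
Proof. by rewrite /rnorm normrN. Qed.

Lemma rnorm0 : rnorm (0 : V) = 0.
Proof. by rewrite /rnorm normr0. Qed.

Lemma rnorm0_eq0 x : rnorm x = 0 -> x = 0.
Proof. by move=> x0; apply: normr0_eq0; rewrite -rnormK x0. Qed.
End Rnorm.



Lemma gt0_complexP (R : realType) (e : R[i]) :
  0 < e -> exists2 r : R, 0 < r & e = r%:C.
Proof.
move=> e0; have eE : e = (Re e)%:C by rewrite RRe_real// gtr0_real.
by exists (Re e) => //; rewrite -ltcR -eE.
Qed.

(* The C*-algebra of complex numbers, as an alias: R[i]^o cannot carry a second
   complete structure next to the generic one of real fields. *)
Definition cplx (R : realType) : Type := R[i]^o.
HB.instance Definition _ (R : realType) := NormedModule.copy (cplx R) R[i]^o.

Section ComplexStarAlg.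
Variable R : realType.
Local Notation C := (cplx R).
Let smulZl (a : R[i]) (x y : R[i]^o) : (a *: x) * y = a *: (x * y).
Proof. by rewrite /GRing.scale/= mulrA. Qed.
Let smulZr (a : R[i]) (x y : R[i]^o) : x * (a *: y) = a *: (x * y).
Proof. by rewrite /GRing.scale/= mulrCA. Qed.
Let starD : {morph (@conjc R : C -> C) : x y / x + y}.
Proof. exact: rmorphD. Qed.
Let starZ (a : R[i]) (x : C) : conjc (a *: x) = (conjc a : R[i]) *: (conjc x : C).
Proof. exact: rmorphM. Qed.
Let starM (x y : R[i]) : conjc (x * y) = conjc y * conjc x.
Proof. by rewrite mulrC; exact: rmorphM. Qed.
Let norm_smul (x y : R[i]) : `|x * y| <= `|x| * `|y|.
Proof. by rewrite (normrM x). Qed.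
HB.instance Definition _ := NormedModule_isStarAlg.Build R C
  (@mulrA R[i]) (@mulrDl R[i]) (@mulrDr R[i]) smulZl smulZr
  (@conjcK R) starD starZ starM norm_smul (@normcJ R).

Let cstar_norm (x : C) : `|star x ⋆ x| = `|x| ^+ 2.
Proof. by rewrite (normrM (conjc x)) normcJ expr2. Qed.

Let complete (F : set_system C) : ProperFilter F -> cauchy F -> cvg F.
Proof.
move=> FF Fc.
have key (g : C -> R) : (forall x y, `|g x - g y|%:C <= `|x - y|) -> 
   cvg (g @ F).
  move=> gl; apply: R_complete; apply/cauchy_ballP => e e0.
  have /cauchy_ballP/(_ (e%:C)) := Fc; rewrite ltcR => /(_ e0).
  case=> -[P Q]/= [FP FQ] PQ.
  exists (g @` P, g @` Q).
    by split; [apply: filterS FP | apply: filterS FQ] => x Px; exists x.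
  case=> _ _ /= [[x Px <-] [y Qy <-]]; have /= := PQ (x, y) (conj Px Qy).
  rewrite -!ball_normE/= -[in X in _ -> X]ltcR; exact: le_lt_trans.
have reP : cvg ((@Re R : C -> R) @ F).
  apply: key => x y; have -> : Re x - Re y = Re (x - y : R[i]).
    by case: x y => ? ? [].
  exact: normc_ge_Re.
have imP : cvg ((@Im R : C -> R) @ F).
  apply: key => x y.
  have -> : Im x - Im y = - Re ((x - y : R[i]) * 'i%C).
    by rewrite ReiNIm opprK; case: x y => ? ? [].
  apply: le_trans (_ : `|(x - y) * 'i%C : R[i]| <= _).
    by rewrite normrN normc_ge_Re.
  by rewrite normrM [X in _ * X](_ : _ = 1) ?mulr1// normc_def/= expr0n/= expr1n add0r sqrtr1.
pose l : C := (lim ((@Re R : C -> R) @ F)) +i* (lim ((@Im R : C -> R) @ F)).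
apply/cvg_ex; exists l; apply/cvgrPdist_lt => _ /gt0_complexP[e e0 ->].
have e20 : 0 < e / 2 by rewrite divr_gt0.
move/cvgrPdist_lt : reP => /(_ _ e20) reP.
move/cvgrPdist_lt : imP => /(_ _ e20) imP.
have lz (z : C) : l - z = (Re l - Re z)%:C + 'i%C * (Im l - Im z)%:C :> R[i].
  by rewrite [LHS]complexE; case: z.
near=> z; rewrite lz.
apply: le_lt_trans (ler_normD _ _) _.
rewrite normrM [`|'i%C|](_ : _ = 1) ?mul1r; last first.
  by rewrite normc_def/= expr0n/= expr1n add0r sqrtr1.
rewrite !normc_def/= !expr0n/= !addr0 !sqrtr_sqr -rmorphD ltcR.
rewrite (splitr e) ltrD//; near: z; [exact: reP|exact: imP].
Unshelve. all: by end_near. Qed.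

HB.instance Definition _ := Uniform_isComplete.Build C complete.
HB.instance Definition _ := NormedStarAlg_isCstar.Build R C cstar_norm.
End ComplexStarAlg.

(* The bounded functions T -> B with pointwise operations and sup norm. *)
Section Linfty.
Context {R : realType} {T : Type} {B : normedStarAlgType R}.

Definition bounded_pred : {pred T -> B} :=
  fun f => `[< exists M : R, forall t, rnorm (f t) <= M >].

Let bounded_submod : subsemimod_closed bounded_pred.
Proof.
split; first split.
- by apply/asboolP; exists 0 => t; rewrite rnorm0.
- move=> f g /asboolP[M fM] /asboolP[N gN]; apply/asboolP; exists (M + N) => t.
  by rewrite (le_trans (rnormD _ _))// lerD.
- move=> a f /asboolP[M fM]; apply/asboolP.
  exists (rnorm (a : R[i]^o) * M) => t.
  by rewrite rnormZ ler_wpM2l// rnorm_ge0.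
Qed.

Record linfty := Linfty {
  linfty_fun :> T -> B;
  linfty_bounded : linfty_fun \in bounded_pred }.

HB.instance Definition _ := [isSub for linfty_fun].
HB.instance Definition _ := [Choice of linfty by <:].
HB.instance Definition _ :=
  GRing.SubChoice_isSubLmodule.Build R[i] (T -> B) bounded_pred linfty
    bounded_submod.

Implicit Types f g : linfty.

Lemma linftyP f g : f =1 g -> f = g.
Proof. by move=> fg; apply/val_inj/funext. Qed.

Lemma linfty_boundedP f : exists M : R, forall t, rnorm (f t) <= M.
Proof. exact/asboolP/linfty_bounded. Qed.

Definition sup_norm f : R := sup [set rnorm (f t) | t in [set: T]].

Lemma sup_norm_ge f t : rnorm (f t) <= sup_norm f.
Proof.
apply: ub_le_sup; last by exists t.
by have [M fM] := linfty_boundedP f; exists M => _ [s _ <-].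
Qed.

Lemma sup_norm_le f (M : R) : 0 <= M ->
  (forall t, rnorm (f t) <= M) -> sup_norm f <= M.
Proof.
move=> M0 fM; have [[t]|nT] := pselect (inhabited T).
  by apply: ge_sup => [|_ [s _ <-]]//; exists (rnorm (f t)); exists t.
rewrite /sup_norm (_ : [set _ | _ in _] = set0) ?sup0//.
by rewrite -subset0 => x [t]; case: nT.
Qed.

Lemma sup_norm_ge0 f : 0 <= sup_norm f.
Proof.
have [[t]|nT] := pselect (inhabited T).
  exact: le_trans (rnorm_ge0 (f t)) (sup_norm_ge f t).
rewrite /sup_norm (_ : [set _ | _ in _] = set0) ?sup0//.
by rewrite -subset0 => x [t]; case: nT.
Qed.

Let norm f : R[i] := (sup_norm f)%:C.

Let ler_normD f g : norm (f + g) <= norm f + norm g.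
Proof.
rewrite /norm -rmorphD lecR; apply: sup_norm_le => [|t].
  by rewrite addr_ge0// sup_norm_ge0.
by rewrite (le_trans (rnormD _ _))// lerD// sup_norm_ge.
Qed.

Let normrZ (a : R[i]) f : norm (a *: f) = `|a| * norm f.
Proof.
rewrite /norm -[`|a|](rnormK (a : R[i]^o)) -rmorphM; congr (_%:C).
have le (b : R[i]) g : sup_norm (b *: g) <= rnorm (b : R[i]^o) * sup_norm g.
  apply: sup_norm_le => [|t].
    by rewrite mulr_ge0// ?rnorm_ge0 ?sup_norm_ge0.
  by rewrite rnormZ ler_wpM2l ?rnorm_ge0 ?sup_norm_ge.
apply/eqP; rewrite eq_le le/=; have [->|a0] := eqVneq a 0.
  by rewrite rnorm0 mul0r sup_norm_ge0.
have a1 : rnorm (a : R[i]^o) > 0.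
  by rewrite -ltcR rnormK normr_gt0.
rewrite -ler_pdivlMl//; apply: le_trans (_ : sup_norm (a^-1 *: (a *: f)) <= _).
  by rewrite scalerA mulVf// scale1r.
apply: le_trans (le _ _) _; rewrite ler_wpM2r ?sup_norm_ge0//.
rewrite -lecR fmorphV/= !rnormK.
by rewrite normfV.
Qed.

Let normr0_eq0 f : norm f = 0 -> f = 0.
Proof.
move=> /complexI f0; apply: linftyP => t.
apply: rnorm0_eq0; apply/eqP; rewrite eq_le rnorm_ge0 andbT.
by rewrite -f0 sup_norm_ge.
Qed.

HB.instance Definition _ :=
  Lmodule_isNormed.Build R[i] linfty ler_normD normrZ normr0_eq0.

Lemma rnorm_linftyE f : rnorm f = sup_norm f.
Proof. by []. Qed.

Fact linfty_smul_subproof f g : (fun t => f t ⋆ g t) \in bounded_pred.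
Proof.
apply/asboolP; exists (rnorm f * rnorm g) => t.
rewrite -lecR rmorphM/= !rnormK (le_trans (norm_smul _ _))//.
by rewrite ler_pM// -!rnormK lecR; exact: sup_norm_ge.
Qed.

Fact linfty_star_subproof f : (fun t => star (f t)) \in bounded_pred.
Proof.
by apply/asboolP; exists (rnorm f) => t; rewrite /rnorm norm_star sup_norm_ge.
Qed.

Definition linfty_smul f g := Linfty (linfty_smul_subproof f g).
Definition linfty_star f := Linfty (linfty_star_subproof f).

Let smulA : associative linfty_smul.
Proof. by move=> f g h; apply: linftyP => t; exact: smulA. Qed.
Let smulDl : left_distributive linfty_smul +%R.
Proof. by move=> f g h; apply: linftyP => t; exact: smulDl. Qed.
Let smulDr : right_distributive linfty_smul +%R.
Proof. by move=> f g h; apply: linftyP => t; exact: smulDr. Qed.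
Let smulZl (a : R[i]) f g : linfty_smul (a *: f) g = a *: linfty_smul f g.
Proof. by apply: linftyP => t; exact: smulZl. Qed.
Let smulZr (a : R[i]) f g : linfty_smul f (a *: g) = a *: linfty_smul f g.
Proof. by apply: linftyP => t; exact: smulZr. Qed.
Let starK : involutive linfty_star.
Proof. by move=> f; apply: linftyP => t; exact: starK. Qed.
Let starD : {morph linfty_star : f g / f + g}.
Proof. by move=> f g; apply: linftyP => t; exact: starD. Qed.
Let starZ (a : R[i]) f : linfty_star (a *: f) = conjc a *: linfty_star f.
Proof. by apply: linftyP => t; exact: starZ. Qed.
Let starM f g :
  linfty_star (linfty_smul f g) = linfty_smul (linfty_star g) (linfty_star f).
Proof. by apply: linftyP => t; exact: starM. Qed.
Let norm_smul f g : `|linfty_smul f g| <= `|f| * `|g|.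
Proof.
rewrite -!rnormK -rmorphM lecR; apply: sup_norm_le => [|t].
  by rewrite mulr_ge0 ?rnorm_ge0.
rewrite -lecR rmorphM/= !rnormK (le_trans (norm_smul _ _))//.
by rewrite ler_pM// -!rnormK lecR; exact: sup_norm_ge.
Qed.
Let norm_star f : `|linfty_star f| = `|f|.
Proof.
have le g : rnorm (linfty_star g) <= rnorm g.
  apply: sup_norm_le => [|t]; first exact: rnorm_ge0.
  by rewrite /rnorm norm_star; exact: sup_norm_ge.
rewrite -!rnormK; congr (_%:C); apply/eqP; rewrite eq_le le/=.
by rewrite -{1}[f]starK le.
Qed.

HB.instance Definition _ := NormedModule_isStarAlg.Build R linfty
  smulA smulDl smulDr smulZl smulZr starK starD starZ starM norm_smul norm_star.

Lemma linftyDE f g t : (f + g) t = f t + g t. Proof. by []. Qed.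
Lemma linftyZE (a : R[i]) f t : (a *: f) t = a *: f t. Proof. by []. Qed.
Lemma linftyME f g t : (f ⋆ g) t = f t ⋆ g t. Proof. by []. Qed.
Lemma linfty_starE f t : star f t = star (f t). Proof. by []. Qed.

End Linfty.
Arguments linfty {R} T B.
Arguments bounded_pred {R T B}.

Section LinftyCstar.
Context {R : realType} {T : Type} {B : cstarAlgType R}.
Local Notation L := (linfty T B).

Let cstar_norm (f : L) : `|star f ⋆ f| = `|f| ^+ 2.
Proof.
apply/eqP; rewrite eq_le; apply/andP; split.
  by rewrite expr2 -[X in _ <= X * _]norm_star norm_smul.
rewrite -!rnormK -rmorphXn lecR/=.
rewrite -[leRHS]sqr_sqrtr ?rnorm_ge0// ler_pXn2r ?nnegrE ?rnorm_ge0 ?sqrtr_ge0//.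
apply: sup_norm_le => [|t]; first exact: sqrtr_ge0.
rewrite -[leLHS](ger0_norm (rnorm_ge0 _)) -sqrtr_sqr ler_wsqrtr//.
apply: le_trans (sup_norm_ge (star f ⋆ f) t).
by rewrite -lecR rmorphXn/= !rnormK -cstar_norm.
Qed.

Let complete (F : set_system L) : ProperFilter F -> cauchy F -> cvg F.
Proof.
move=> FF Fc.
have Fe (e : R) : 0 < e -> exists2 P, F P &
    forall f g t, P f -> P g -> rnorm (f t - g t) < e.
  move=> e0; have /cauchy_ballP/(_ e%:C) := Fc; rewrite ltcR => /(_ e0).
  case=> -[P Q]/= [FP FQ] PQ; exists (P `&` Q); first exact: filterI.
  move=> f g t [Pf _] [_ Qg]; have /= := PQ (f, g) (conj Pf Qg).
  rewrite -ball_normE/= rnorm_lt; apply: le_lt_trans.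
  exact: (sup_norm_ge (f - g) t).
have ptw t : cvg ((fun f : L => f t) @ F).
  apply: cauchy_cvg; apply/cauchy_ballP => _ /gt0_complexP[e e0 ->].
  have [P FP PP] := Fe _ e0.
  exists ((fun f : L => f t) @` P, (fun f : L => f t) @` P).
    by split => /=; apply: (@filterS _ F _ P _ _ FP) => f Pf; exists f.
  case=> _ _ /= [[f Pf <-] [g Pg <-]].
  by rewrite -ball_normE/= rnorm_lt PP.
pose l t : B := lim ((fun f : L => f t) @ F).
have Fl (e : R) : 0 < e -> exists2 P, F P &
    forall f t, P f -> rnorm (l t - f t) <= e.
  move=> e0; have [P FP PP] := Fe _ e0; exists P => // f t Pf.
  apply/ler_addgt0Pr => d d0.
  have d0C : 0 < d%:C by rewrite ltcR.
  have /cvgrPdist_lt/(_ _ d0C) lt := ptw t.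
  have [g [Pg]] := @filter_ex _ F _ _ (filterI FP lt).
  rewrite rnorm_lt => gd.
  rewrite -(subrKA (g t)) (le_trans (rnormD _ _))// addrC lerD// ltW//.
  exact: PP.
have lb : l \in bounded_pred.
  have [P FP PP] := Fl _ ltr01; have [f Pf] := @filter_ex _ F _ _ FP.
  have [M fM] := linfty_boundedP f; apply/asboolP; exists (1 + M) => t.
  rewrite -[l t](subrK (f t)) (le_trans (rnormD _ _))// lerD//; exact: PP.
apply/cvg_ex; exists (Linfty lb); apply/cvgrPdist_le => _ /gt0_complexP[e e0 ->].
have [P FP PP] := Fl _ e0; apply: filterS FP => f Pf.
rewrite rnorm_le; apply: sup_norm_le => [|t]; first exact: ltW.
exact: PP.
Qed.

HB.instance Definition _ := Uniform_isComplete.Build L complete.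
HB.instance Definition _ := NormedStarAlg_isCstar.Build R L cstar_norm.
End LinftyCstar.

(* Norm-closed *-subalgebras; these are the C*-subalgebras when B is a
   C*-algebra. *)
Record starSubalg (R : realType) (B : normedStarAlgType R) := StarSubalg {
  subalg_set : set B;
  subalg_closed : closed subalg_set;
  subalg0 : subalg_set 0;
  subalgD : forall x y, subalg_set x -> subalg_set y -> subalg_set (x + y);
  subalgZ : forall (a : R[i]) x, subalg_set x -> subalg_set (a *: x);
  subalgM : forall x y, subalg_set x -> subalg_set y -> subalg_set (x ⋆ y);
  subalg_star : forall x, subalg_set x -> subalg_set (star x)
}.

Section Subalg.
Context {R : realType} {B : normedStarAlgType R} (S : starSubalg B).

Definition subalg_pred : {pred B} := fun x => `[< subalg_set S x >].

Let subalg_submod : subsemimod_closed subalg_pred.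
Proof.
split; first split.
- exact/asboolP/subalg0.
- by move=> x y /asboolP Sx /asboolP Sy; apply/asboolP/subalgD.
- by move=> a x /asboolP Sx; apply/asboolP/subalgZ.
Qed.

Record subalg := Subalg { subalg_val : B; subalg_in : subalg_val \in subalg_pred }.

HB.instance Definition _ := [isSub for subalg_val].
HB.instance Definition _ := [Choice of subalg by <:].
HB.instance Definition _ :=
  GRing.SubChoice_isSubLmodule.Build R[i] B subalg_pred subalg subalg_submod.

Implicit Types x y : subalg.

Lemma subalg_valP x : subalg_set S (subalg_val x).
Proof. exact/asboolP/subalg_in. Qed.

Definition subalg_of (b : B) (Sb : subalg_set S b) : subalg := Subalg (asboolT Sb).

Let norm x : R[i] := `|subalg_val x|.
Let norm_triangle x y : norm (x + y) <= norm x + norm y.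
Proof. exact: ler_normD. Qed.
Let norm_scale (a : R[i]) x : norm (a *: x) = `|a| * norm x.
Proof. exact: normrZ. Qed.
Let norm_eq0 x : norm x = 0 -> x = 0.
Proof. by move=> /normr0_eq0 x0; apply: val_inj. Qed.

HB.instance Definition _ :=
  Lmodule_isNormed.Build R[i] subalg norm_triangle norm_scale norm_eq0.

Definition subalg_smul x y : subalg :=
  subalg_of (subalgM (subalg_valP x) (subalg_valP y)).
Definition subalg_starop x : subalg := subalg_of (subalg_star (subalg_valP x)).

Let smulA : associative subalg_smul.
Proof. by move=> x y z; apply/val_inj/smulA. Qed.
Let smulDl : left_distributive subalg_smul +%R.
Proof. by move=> x y z; apply/val_inj/smulDl. Qed.
Let smulDr : right_distributive subalg_smul +%R.
Proof. by move=> x y z; apply/val_inj/smulDr. Qed.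
Let smulZl (a : R[i]) x y : subalg_smul (a *: x) y = a *: subalg_smul x y.
Proof. exact/val_inj/smulZl. Qed.
Let smulZr (a : R[i]) x y : subalg_smul x (a *: y) = a *: subalg_smul x y.
Proof. exact/val_inj/smulZr. Qed.
Let starK : involutive subalg_starop.
Proof. by move=> x; apply/val_inj/starK. Qed.
Let starD : {morph subalg_starop : x y / x + y}.
Proof. by move=> x y; apply/val_inj/starD. Qed.
Let starZ (a : R[i]) x : subalg_starop (a *: x) = conjc a *: subalg_starop x.
Proof. exact/val_inj/starZ. Qed.
Let starM x y :
  subalg_starop (subalg_smul x y) = subalg_smul (subalg_starop y) (subalg_starop x).
Proof. exact/val_inj/starM. Qed.
Let norm_smul x y : `|subalg_smul x y| <= `|x| * `|y|.
Proof. exact: (norm_smul (subalg_val x) (subalg_val y)). Qed.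
Let norm_star x : `|subalg_starop x| = `|x|.
Proof. exact: (norm_star (subalg_val x)). Qed.

HB.instance Definition _ := NormedModule_isStarAlg.Build R subalg
  smulA smulDl smulDr smulZl smulZr starK starD starZ starM norm_smul norm_star.

Lemma subalg_valD x y : subalg_val (x + y) = subalg_val x + subalg_val y.
Proof. by []. Qed.
Lemma subalg_valZ (a : R[i]) x : subalg_val (a *: x) = a *: subalg_val x.
Proof. by []. Qed.
Lemma subalg_valM x y : subalg_val (x ⋆ y) = subalg_val x ⋆ subalg_val y.
Proof. by []. Qed.
Lemma subalg_val_star x : subalg_val (star x) = star (subalg_val x).
Proof. by []. Qed.

End Subalg.
Coercion subalg : starSubalg >-> Sortclass.
Arguments subalg_of {R B} S {b} Sb.

Section SubalgCstar.
Context {R : realType} {A : cstarAlgType R} (S : starSubalg A).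

Let cstar_norm (x : subalg S) : `|star x ⋆ x| = `|x| ^+ 2.
Proof. exact: (cstar_norm (subalg_val x)). Qed.

Let complete (F : set_system (subalg S)) : ProperFilter F -> cauchy F -> cvg F.
Proof.
move=> FF Fc.
have vF : cvg ((@subalg_val _ _ S) @ F).
  apply: cauchy_cvg; apply/cauchy_ballP => e e0.
  have /cauchy_ballP/(_ e e0) := Fc; case=> -[P Q]/= [FP FQ] PQ.
  exists ((@subalg_val _ _ S) @` P, (@subalg_val _ _ S) @` Q).
    by split => /=; [apply: (@filterS _ F _ P _ _ FP)|
      apply: (@filterS _ F _ Q _ _ FQ)] => x Px; exists x.
  case=> _ _ /= [[x Px <-] [y Qy <-]].
  by have /= := PQ (x, y) (conj Px Qy); rewrite -!ball_normE.
have Sl : subalg_set S (lim ((@subalg_val _ _ S) @ F)).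
  apply: (@closed_cvg _ _ F _ (@subalg_val _ _ S) (subalg_set S) (@subalg_closed _ _ S)) vF.
  by apply: filterE => x; exact: subalg_valP.
apply/cvg_ex; exists (subalg_of S Sl); apply/cvgrPdist_lt => e e0.
by have /cvgrPdist_lt/(_ e e0) := vF.
Qed.

HB.instance Definition _ := Uniform_isComplete.Build (subalg S) complete.
HB.instance Definition _ := NormedStarAlg_isCstar.Build R (subalg S) cstar_norm.
End SubalgCstar.

(* Norm-closed two-sided *-ideals, by which one takes quotients. *)
Record starIdeal (R : realType) (B : normedStarAlgType R) := StarIdeal {
  ideal_set : set B;
  ideal_closed : closed ideal_set;
  ideal0 : ideal_set 0;
  idealD : forall x y, ideal_set x -> ideal_set y -> ideal_set (x + y);
  idealZ : forall (a : R[i]) x, ideal_set x -> ideal_set (a *: x);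
  idealMl : forall x y, ideal_set y -> ideal_set (x ⋆ y);
  idealMr : forall x y, ideal_set x -> ideal_set (x ⋆ y);
  ideal_star : forall x, ideal_set x -> ideal_set (star x)
}.

Section Quotient.
Context {R : realType} {B : normedStarAlgType R} (J : starIdeal B).

Definition ideal_pred : {pred B} := fun x => `[< ideal_set J x >].

Let ideal_zmod : zmod_closed ideal_pred.
Proof.
split; first exact/asboolP/ideal0.
move=> x y /asboolP Jx /asboolP Jy; apply/asboolP.
by rewrite -scaleN1r; apply/idealD/idealZ.
Qed.
HB.instance Definition _ := GRing.isZmodClosed.Build B ideal_pred ideal_zmod.

Definition quotalg : Type := (Quotient.quot ideal_pred).
HB.instance Definition _ := GRing.Zmodule.copy quotalg (Quotient.quot ideal_pred).

Definition qpi (x : B) : quotalg := \pi_(Quotient.quot ideal_pred) x.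
Definition qrepr (q : quotalg) : B := repr (q : (Quotient.quot ideal_pred)).

Implicit Types (x y : B) (p q : quotalg).

Lemma qreprK q : qpi (qrepr q) = q.
Proof. exact: reprK. Qed.

Lemma qpiP x y : qpi x = qpi y <-> ideal_set J (x - y).
Proof.
split=> [/eqP|Jxy]; last apply/eqP.
  by rewrite /qpi -Quotient.idealrBE => /asboolP.
by rewrite /qpi -Quotient.idealrBE; apply/asboolP.
Qed.

Lemma qpi_repr x : ideal_set J (qrepr (qpi x) - x).
Proof. by apply/qpiP; rewrite qreprK. Qed.

Lemma qpiD x y : qpi (x + y) = qpi x + qpi y.
Proof. by rewrite /qpi !piE. Qed.

Lemma qpi0 : qpi 0 = 0.
Proof. by rewrite /qpi !piE. Qed.

Definition qscale (a : R[i]) q := qpi (a *: qrepr q).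
Definition qsmul p q := qpi (qrepr p ⋆ qrepr q).
Definition qstar q := qpi (star (qrepr q)).

Lemma qpi_scale a x : qscale a (qpi x) = qpi (a *: x).
Proof. by apply/qpiP; rewrite -scalerBr; apply/idealZ/qpi_repr. Qed.

Lemma qpi_smul x y : qsmul (qpi x) (qpi y) = qpi (x ⋆ y).
Proof.
apply/qpiP; rewrite -(subrKA (x ⋆ qrepr (qpi y))) -smulBl -smulBr.
by apply: idealD; [apply: idealMr|apply: idealMl]; exact: qpi_repr.
Qed.

Lemma qpi_star x : qstar (qpi x) = qpi (star x).
Proof. by apply/qpiP; rewrite -starB; apply/ideal_star/qpi_repr. Qed.

Lemma quotP (P : quotalg -> Prop) : (forall x, P (qpi x)) -> forall q, P q.
Proof. by move=> H q; rewrite -[q]qreprK. Qed.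

Let scalerA a b q : qscale a (qscale b q) = qscale (a * b) q.
Proof. by elim/quotP: q => x; rewrite !qpi_scale scalerA. Qed.
Let scale1r : left_id 1 qscale.
Proof. by elim/quotP => x; rewrite qpi_scale scale1r. Qed.
Let scalerDr : right_distributive qscale +%R.
Proof.
move=> a; elim/quotP => x; elim/quotP => y.
by rewrite -qpiD !qpi_scale -qpiD scalerDr.
Qed.
Let scalerDl q : {morph qscale^~ q : a b / a + b}.
Proof. by elim/quotP: q => x a b; rewrite !qpi_scale -qpiD scalerDl. Qed.

HB.instance Definition _ := GRing.Zmodule_isLmodule.Build R[i] quotalg
  scalerA scale1r scalerDr scalerDl.

Lemma qpiZ a x : qpi (a *: x) = a *: qpi x.
Proof. by rewrite -qpi_scale. Qed.

(* The quotient norm. *)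
Definition quot_norm q : R := inf [set rnorm x | x in [set x | qpi x = q]].

Let has_lb q : has_lbound [set rnorm x | x in [set x | qpi x = q]].
Proof. by exists 0 => _ [x _ <-]; exact: rnorm_ge0. Qed.

Let nonempty q : [set rnorm x | x in [set x | qpi x = q]] !=set0.
Proof. by exists (rnorm (qrepr q)), (qrepr q); first exact: qreprK. Qed.

Lemma quot_norm_le x : quot_norm (qpi x) <= rnorm x.
Proof. by apply: ge_inf => //; exists x. Qed.

Lemma quot_norm_ge q (c : R) :
  (forall x, qpi x = q -> c <= rnorm x) -> c <= quot_norm q.
Proof. by move=> H; apply: lb_le_inf => // _ [x xq <-]; exact: H. Qed.

Lemma quot_norm_ge0 q : 0 <= quot_norm q.
Proof. by apply: quot_norm_ge => x _; exact: rnorm_ge0. Qed.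

Lemma quot_norm_mul_ge q (c r : R) : 0 <= r ->
  (forall x, qpi x = q -> c <= rnorm x * r) -> c <= quot_norm q * r.
Proof.
rewrite le_eqVlt => /predU1P[<-|r0] H.
  by have := H _ (qreprK q); rewrite !mulr0.
rewrite -ler_pdivrMr//; apply: quot_norm_ge => x xq.
by rewrite ler_pdivrMr// H.
Qed.

Let norm q : R[i] := (quot_norm q)%:C.

Let norm_triangle p q : norm (p + q) <= norm p + norm q.
Proof.
rewrite /norm -rmorphD lecR -lerBlDr; apply: quot_norm_ge => x xp.
rewrite lerBlDr -lerBlDl; apply: quot_norm_ge => y yq.
by rewrite lerBlDl -xp -yq -qpiD (le_trans (quot_norm_le _))// rnormD.
Qed.

Let norm_scale (a : R[i]) q : norm (a *: q) = `|a| * norm q.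
Proof.
rewrite /norm -[`|a|](rnormK (a : R[i]^o)) -rmorphM; congr (_%:C).
have le (b : R[i]) p : quot_norm (b *: p) <= rnorm (b : R[i]^o) * quot_norm p.
  rewrite mulrC; apply: quot_norm_mul_ge => [|x <-]; first exact: rnorm_ge0.
  by rewrite -qpiZ mulrC -rnormZ quot_norm_le.
apply/eqP; rewrite eq_le le/=; have [->|a0] := eqVneq a 0.
  by rewrite rnorm0 mul0r quot_norm_ge0.
have a1 : rnorm (a : R[i]^o) > 0 by rewrite -ltcR rnormK normr_gt0.
rewrite -ler_pdivlMl//; apply: le_trans (_ : quot_norm (a^-1 *: (a *: q)) <= _).
  by rewrite GRing.scalerA mulVf// GRing.scale1r.
apply: le_trans (le _ _) _; rewrite ler_wpM2r ?quot_norm_ge0//.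
by rewrite -lecR fmorphV/= !rnormK normfV.
Qed.

Let norm_eq0 q : norm q = 0 -> q = 0.
Proof.
move=> /complexI; elim/quotP: q => x x0; rewrite -qpi0; apply/qpiP.
rewrite subr0; apply: (@ideal_closed _ _ J) => U.
move=> /nbhs_ballP[_ /= /gt0_complexP[e e0 ->] xU].
have : quot_norm (qpi x) < e by rewrite x0.
move=> /(inf_lt (nonempty _)) [_ [y yx <-] ye].
exists (x - y); split; first exact/qpiP/esym.
by apply: xU; rewrite -ball_normE/= opprB addrC subrK rnorm_lt.
Qed.

HB.instance Definition _ :=
  Lmodule_isNormed.Build R[i] quotalg norm_triangle norm_scale norm_eq0.

Lemma rnorm_quotE q : rnorm q = quot_norm q.
Proof. by []. Qed.

Let smulA : associative qsmul.
Proof.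
elim/quotP => x; elim/quotP => y; elim/quotP => z.
by rewrite !qpi_smul smulA.
Qed.
Let smulDl : left_distributive qsmul +%R.
Proof.
elim/quotP => x; elim/quotP => y; elim/quotP => z.
by rewrite -qpiD !qpi_smul -qpiD smulDl.
Qed.
Let smulDr : right_distributive qsmul +%R.
Proof.
elim/quotP => x; elim/quotP => y; elim/quotP => z.
by rewrite -qpiD !qpi_smul -qpiD smulDr.
Qed.
Let smulZl (a : R[i]) p q : qsmul (a *: p) q = a *: qsmul p q.
Proof.
elim/quotP: p => x; elim/quotP: q => y.
by rewrite -qpiZ !qpi_smul -qpiZ smulZl.
Qed.
Let smulZr (a : R[i]) p q : qsmul p (a *: q) = a *: qsmul p q.
Proof.
elim/quotP: p => x; elim/quotP: q => y.
by rewrite -qpiZ !qpi_smul -qpiZ smulZr.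
Qed.
Let starK : involutive qstar.
Proof. by elim/quotP => x; rewrite !qpi_star starK. Qed.
Let starD : {morph qstar : p q / p + q}.
Proof.
elim/quotP => x; elim/quotP => y.
by rewrite -qpiD !qpi_star -qpiD starD.
Qed.
Let starZ (a : R[i]) q : qstar (a *: q) = conjc a *: qstar q.
Proof. by elim/quotP: q => x; rewrite -qpiZ !qpi_star -qpiZ starZ. Qed.
Let starM p q : qstar (qsmul p q) = qsmul (qstar q) (qstar p).
Proof.
elim/quotP: p => x; elim/quotP: q => y.
by rewrite !(qpi_smul, qpi_star) starM.
Qed.
Let norm_smul p q : `|qsmul p q| <= `|p| * `|q|.
Proof.
rewrite -!rnormK -rmorphM lecR !rnorm_quotE.
apply: quot_norm_mul_ge => [|x <-]; first exact: quot_norm_ge0.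
rewrite mulrC; apply: quot_norm_mul_ge => [|y <-]; first exact: rnorm_ge0.
rewrite qpi_smul (le_trans (quot_norm_le _))//.
by rewrite -lecR rmorphM/= !rnormK mulrC norm_smul.
Qed.
Let norm_star q : `|qstar q| = `|q|.
Proof.
have le p : rnorm (qstar p) <= rnorm p.
  apply: quot_norm_ge => x <-; rewrite qpi_star.
  by apply: le_trans (quot_norm_le _) _; rewrite /rnorm norm_star.
rewrite -!rnormK; congr (_%:C); apply/eqP; rewrite eq_le le/=.
by rewrite -{1}[q]starK le.
Qed.

HB.instance Definition _ := NormedModule_isStarAlg.Build R quotalg
  smulA smulDl smulDr smulZl smulZr starK starD starZ starM norm_smul norm_star.

Lemma qpiM x y : qpi (x ⋆ y) = qpi x ⋆ qpi y.
Proof. by rewrite -qpi_smul. Qed.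
End Quotient.

Section SmulContinuous.
Context {R : realType} {B : normedStarAlgType R}.

Lemma smul_continuousl (b : B) : continuous (fun x : B => b ⋆ x).
Proof.
move=> x; apply/cvgrPdist_lt => _ /gt0_complexP[e e0 ->].
have b1 : 0 < rnorm b + 1 by rewrite ltr_wpDl// rnorm_ge0.
have d0 : 0 < e / (rnorm b + 1) by rewrite divr_gt0.
have d0C : 0 < (e / (rnorm b + 1))%:C by rewrite ltcR.
have /cvgrPdist_lt/(_ _ d0C) := @cvg_id _ (nbhs x).
apply: filterS => y; rewrite !rnorm_lt => xy; rewrite -smulBr.
apply: le_lt_trans (_ : rnorm b * rnorm (x - y) < _).
  by rewrite -lecR rmorphM/= !rnormK norm_smul.
apply: le_lt_trans (_ : (rnorm b + 1) * rnorm (x - y) < _).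
  by rewrite ler_wpM2r ?rnorm_ge0// lerDl.
by rewrite mulrC -ltr_pdivlMr.
Qed.

Lemma star_continuous : continuous (@star R B).
Proof.
move=> x; apply/cvgrPdist_lt => e e0.
have /cvgrPdist_lt/(_ _ e0) := @cvg_id _ (nbhs x).
by apply: filterS => y xy; rewrite -starB norm_star.
Qed.

Lemma smul_continuousr (b : B) : continuous (fun x : B => x ⋆ b).
Proof.
have -> : (fun x : B => x ⋆ b) = star \o (fun y => star b ⋆ y) \o star.
  by apply/funext => x /=; rewrite starM !starK.
move=> x; apply: continuous_comp; first exact: star_continuous.
apply: continuous_comp; first exact: smul_continuousl.
exact: star_continuous.
Qed.

Lemma closed_kernel (f : B -> B) : continuous f -> closed [set x | f x = 0].
Proof.
move=> /continuous_closedP cf; apply: (cf [set 0]).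
exact/accessible_closed_set1/hausdorff_accessible/norm_hausdorff.
Qed.
End SmulContinuous.

Section CentralSequence.
Context {R : realType}.

Section Ainf.
Variable A : normedStarAlgType R.

Fact c0_closed : closed [set f : linfty nat A | f n @[n --> \oo] --> (0 : A)].
Proof.
move=> f clf; apply/cvgrPdist_lt => _ /gt0_complexP[e e0 ->].
have e20 : 0 < (e / 2)%:C by rewrite ltcR divr_gt0.
have [g [/= gc /=]] := clf _ (nbhsx_ballx f _ e20).
rewrite -ball_normE/= rnorm_lt => fg.
have /cvgrPdist_lt/(_ _ e20) := gc; apply: filterS => n.
rewrite !rnorm_lt !sub0r !rnormN => gn.
rewrite -(subrK (g n) (f n)) (le_lt_trans (rnormD _ _))// (splitr e) ltrD//.
exact: le_lt_trans (sup_norm_ge (f - g) n) fg.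
Qed.

Fact c0P (f : linfty nat A) : f n @[n --> \oo] --> (0 : A) <->
  forall e : R, 0 < e -> \forall n \near \oo, rnorm (f n) < e.
Proof.
split => [/cvgrPdist_lt f0 e e0|f0].
  have /f0 : 0 < e%:C by rewrite ltcR.
  by apply: filterS => n; rewrite rnorm_lt sub0r rnormN.
apply/cvgrPdist_lt => _ /gt0_complexP[e e0 ->].
by apply: filterS (f0 _ e0) => n; rewrite rnorm_lt sub0r rnormN.
Qed.

Fact c0_zero : [set f : linfty nat A | f n @[n --> \oo] --> (0 : A)] 0.
Proof. exact: cvg_cst. Qed.

Fact c0_add (f g : linfty nat A) : f n @[n --> \oo] --> (0 : A) ->
  g n @[n --> \oo] --> (0 : A) -> (f + g) n @[n --> \oo] --> (0 : A).
Proof. by move=> f0 g0; rewrite -[0]addr0; exact: cvgD. Qed.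

Fact c0_scale (a : R[i]) (f : linfty nat A) : f n @[n --> \oo] --> (0 : A) ->
  (a *: f) n @[n --> \oo] --> (0 : A).
Proof. by move=> f0; rewrite -(scaler0 _ a); exact: cvgZl_tmp. Qed.

Fact c0_mull (f g : linfty nat A) : g n @[n --> \oo] --> (0 : A) ->
  (f ⋆ g) n @[n --> \oo] --> (0 : A).
Proof.
move=> /c0P g0; apply/c0P => e e0.
have f1 : 0 < rnorm f + 1 by rewrite ltr_wpDl// rnorm_ge0.
have /g0 : 0 < e / (rnorm f + 1) by rewrite divr_gt0.
apply: filterS => n; rewrite ltr_pdivlMr// mulrC; apply: le_lt_trans.
apply: le_trans (_ : rnorm (f n) * rnorm (g n) <= _).
  by rewrite -lecR rmorphM/= !rnormK norm_smul.
by rewrite ler_wpM2r ?rnorm_ge0// (le_trans (sup_norm_ge f n))// lerDl.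
Qed.

Fact c0_star (f : linfty nat A) : f n @[n --> \oo] --> (0 : A) ->
  (star f) n @[n --> \oo] --> (0 : A).
Proof.
move=> /c0P f0; apply/c0P => e /f0; apply: filterS => n.
by rewrite /rnorm norm_star.
Qed.

Fact c0_mulr (f g : linfty nat A) : f n @[n --> \oo] --> (0 : A) ->
  (f ⋆ g) n @[n --> \oo] --> (0 : A).
Proof.
move=> /c0_star f0; rewrite -[f ⋆ g]starK starM.
exact/c0_star/c0_mull.
Qed.

Definition c0 : starIdeal (linfty nat A) :=
  StarIdeal c0_closed c0_zero c0_add c0_scale c0_mull c0_mulr c0_star.

(* A_oo = l^oo(N, A) / c_0(N, A), in which A sits as constant sequences. *)
Definition Ainf : normedStarAlgType R := quotalg c0.

Fact const_bounded (a : A) : (fun _ : nat => a) \in bounded_pred.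
Proof. by apply/asboolP; exists (rnorm a). Qed.

Definition const_seq (a : A) : linfty nat A := Linfty (const_bounded a).

Definition cst_embed (a : A) : Ainf := qpi c0 (const_seq a).

End Ainf.

Context {A : cstarAlgType R} (D : starSubalg A).
Local Notation commutes := [set x : Ainf A |
  forall d, subalg_set D d -> x ⋆ cst_embed d = cst_embed d ⋆ x].

Lemma cst_embed_star (a : A) : cst_embed (star a) = star (cst_embed a).
Proof.
by apply: etrans (esym (qpi_star _ (const_seq a))); congr qpi; exact: linftyP.
Qed.

Fact commutant_closed : closed commutes.
Proof.
have -> : commutes = \bigcap_(d in subalg_set D)
    [set x | x ⋆ cst_embed d - cst_embed d ⋆ x = 0].
  apply/seteqP; split => x /= xD d Dd; first by rewrite /= xD// subrr.
  by apply/eqP; rewrite -subr_eq0; apply/eqP/xD.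
apply: closed_bigI => d _; apply: closed_kernel => x.
exact: (cvgB (@smul_continuousr _ _ (cst_embed d) x)
  (@smul_continuousl _ _ (cst_embed d) x)).
Qed.

Fact commutant0 : commutes 0.
Proof. by move=> d _; rewrite smul0l smul0r. Qed.
Fact commutantD x y : commutes x -> commutes y -> commutes (x + y).
Proof. by move=> xD yD d Dd; rewrite smulDl smulDr xD// yD. Qed.
Fact commutantZ (a : R[i]) x : commutes x -> commutes (a *: x).
Proof. by move=> xD d Dd; rewrite smulZl smulZr xD. Qed.
Fact commutantM x y : commutes x -> commutes y -> commutes (x ⋆ y).
Proof. by move=> xD yD d Dd; rewrite -smulA yD// smulA xD// smulA. Qed.
Fact commutant_star x : commutes x -> commutes (star x).
Proof.
move=> xD d Dd; rewrite -[d]starK cst_embed_star -!starM xD//.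
exact: subalg_star.
Qed.

(* The relative commutant of D in A_oo. *)
Definition commutant : starSubalg (Ainf A) := StarSubalg commutant_closed
  commutant0 commutantD commutantZ commutantM commutant_star.

Local Notation annihilates := [set x : commutant | forall d, subalg_set D d ->
  subalg_val x ⋆ cst_embed d = 0 /\ cst_embed d ⋆ subalg_val x = 0].

Fact annP (x : commutant) :
  annihilates x <-> forall d, subalg_set D d -> subalg_val x ⋆ cst_embed d = 0.
Proof.
split=> [xD d /xD[]//|xD d Dd]; split; first exact: xD.
by rewrite -(subalg_valP x)//; exact: xD.
Qed.

Fact ann_closed : closed annihilates.
Proof.
move=> x clx; apply/annP => d Dd.
have : closed [set y : Ainf A | y ⋆ cst_embed d = 0].
  exact/closed_kernel/smul_continuousr.
apply => U /nbhs_ballP[e /= e0 xU].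
have [y [/annP yD /= xy]] := clx _ (nbhsx_ballx x e e0).
exists (subalg_val y); split; first exact: yD.
by apply: xU; move: xy; rewrite -!ball_normE.
Qed.

Fact ann0 : annihilates 0.
Proof. by apply/annP => d _; exact: smul0l. Qed.
Fact annD x y : annihilates x -> annihilates y -> annihilates (x + y).
Proof.
move=> /annP xD /annP yD; apply/annP => d Dd.
by rewrite [LHS]smulDl xD// yD// addr0.
Qed.
Fact annZ (a : R[i]) x : annihilates x -> annihilates (a *: x).
Proof.
by move=> /annP xD; apply/annP => d Dd; rewrite [LHS]smulZl xD// scaler0.
Qed.
Fact annMl (x y : commutant) : annihilates y -> annihilates (x ⋆ y).
Proof.
by move=> /annP yD; apply/annP => d Dd; rewrite -[LHS]smulA yD// smul0r.
Qed.
Fact ann_star (x : commutant) : annihilates x -> annihilates (star x).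
Proof.
move=> xD; apply/annP => d Dd; rewrite -[d]starK cst_embed_star -[LHS]starM.
by rewrite (xD _ (subalg_star Dd)).2 star0.
Qed.
Fact annMr (x y : commutant) : annihilates x -> annihilates (x ⋆ y).
Proof. by move=> /ann_star xD; rewrite -[_ ⋆ _]starK starM; exact/ann_star/annMl. Qed.

(* The annihilator of D; it lies inside the relative commutant. *)
Definition ann : starIdeal commutant :=
  StarIdeal ann_closed ann0 annD annZ annMl annMr ann_star.

(* F(D, A). *)
Definition Fcentral : normedStarAlgType R := quotalg ann.

End CentralSequence.

(* Homomorphisms G -> Aut(A).  *-automorphisms of C*-algebras are automatically
   isometric; aut_norm records this so that the action extends to bounded
   sequences. *)
Record cstarAction (R : realType) (G : groupType) (A : cstarAlgType R) := {
  aut :> G -> A -> A;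
  aut1 : forall a, aut 1%g a = a;
  autG : forall g h a, aut (g * h)%g a = aut g (aut h a);
  autD : forall g a b, aut g (a + b) = aut g a + aut g b;
  autZ : forall g (c : R[i]) a, aut g (c *: a) = c *: aut g a;
  autM : forall g a b, aut g (a ⋆ b) = aut g a ⋆ aut g b;
  aut_star : forall g a, aut g (star a) = star (aut g a);
  aut_norm : forall g a, `|aut g a| = `|a|
}.

Section InducedAction.
Context {R : realType} {G : groupType} {A : cstarAlgType R}.
Variables (alpha : cstarAction G A) (D : starSubalg A).

Definition invariant : Prop :=
  forall g d, subalg_set D d -> subalg_set D (alpha g d).

Fact seq_act_bounded g (f : linfty nat A) :
  (fun n => alpha g (f n)) \in bounded_pred.
Proof.
by apply/asboolP; exists (rnorm f) => n; rewrite /rnorm aut_norm sup_norm_ge.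
Qed.

Definition seq_act g (f : linfty nat A) : linfty nat A :=
  Linfty (seq_act_bounded g f).

Definition Ainf_act g (q : Ainf A) : Ainf A := qpi (c0 A) (seq_act g (qrepr q)).

Lemma autN g a : alpha g (- a) = - alpha g a.
Proof. by rewrite -scaleN1r autZ scaleN1r. Qed.

Lemma aut0 g : alpha g 0 = 0.
Proof. by rewrite -(scale0r (0 : A)) autZ !scale0r. Qed.

Lemma Ainf_act_pi g f : Ainf_act g (qpi (c0 A) f) = qpi (c0 A) (seq_act g f).
Proof.
apply/qpiP => /=; have /= := qpi_repr (c0 A) f.
set h := qrepr _ => h0; apply/cvgrPdist_lt => e e0.
have /cvgrPdist_lt/(_ _ e0) := h0; apply: filterS => n.
rewrite !sub0r !normrN; apply: le_lt_trans.
by rewrite -[leRHS](aut_norm alpha g) autD autN.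
Qed.

Lemma Ainf_act_smul g (p q : Ainf A) :
  Ainf_act g (p ⋆ q) = Ainf_act g p ⋆ Ainf_act g q.
Proof.
elim/(@quotP _ _ (c0 A)): p => x; elim/(@quotP _ _ (c0 A)): q => y.
rewrite -qpiM !Ainf_act_pi -qpiM; congr qpi; apply: linftyP => n.
exact: autM.
Qed.

Lemma Ainf_act_cst g (a : A) : Ainf_act g (cst_embed a) = cst_embed (alpha g a).
Proof. by rewrite Ainf_act_pi; congr qpi; exact: linftyP. Qed.

Hypothesis Dinv : invariant.

Fact commutant_act_subproof g (x : commutant D) :
  subalg_set (commutant D) (Ainf_act g (subalg_val x)).
Proof.
move=> d Dd; have -> : d = alpha g (alpha g^-1%g d).
  by rewrite -autG mulgV aut1.
rewrite -Ainf_act_cst -!Ainf_act_smul; congr Ainf_act.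
by apply: (subalg_valP x); exact: Dinv.
Qed.

Definition commutant_act g (x : commutant D) : commutant D :=
  subalg_of (commutant D) (commutant_act_subproof g x).

(* The induced action on F(D, A), through a representative; Fcentral_act_pi shows
   that the choice is immaterial. *)
Definition Fcentral_act g (q : Fcentral D) : Fcentral D :=
  qpi (ann D) (commutant_act g (qrepr q)).

Lemma Ainf_actD g (p q : Ainf A) :
  Ainf_act g (p + q) = Ainf_act g p + Ainf_act g q.
Proof.
elim/(@quotP _ _ (c0 A)): p => x; elim/(@quotP _ _ (c0 A)): q => y.
rewrite -qpiD !Ainf_act_pi -qpiD; congr qpi; apply: linftyP => n.
exact: autD.
Qed.

Lemma Ainf_actN g (p : Ainf A) : Ainf_act g (- p) = - Ainf_act g p.
Proof.
have Ainf_act0 : Ainf_act g 0 = 0.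
  by apply: (addrI (Ainf_act g 0)); rewrite -Ainf_actD !addr0.
by apply/eqP; rewrite -subr_eq0 opprK -Ainf_actD addNr Ainf_act0.
Qed.

Lemma Fcentral_act_pi g x :
  Fcentral_act g (qpi (ann D) x) = qpi (ann D) (commutant_act g x).
Proof.
apply/qpiP => d Dd; have /(_ _ (Dinv g^-1%g Dd)) := qpi_repr (ann D) x.
set y := qrepr _ => -[yd dy].
have {1 2}-> : d = alpha g (alpha g^-1%g d) by rewrite -autG mulgV aut1.
have act0 : Ainf_act g 0 = 0.
  by apply: (addrI (Ainf_act g 0)); rewrite -Ainf_actD !addr0.
rewrite [subalg_val _](_ : _ = Ainf_act g (subalg_val (y - x))); last first.
  by rewrite [RHS]Ainf_actD Ainf_actN.
by rewrite -Ainf_act_cst -!Ainf_act_smul yd dy act0.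
Qed.

End InducedAction.

Section Maps.
Context {R : realType} {A B : normedStarAlgType R}.

(* Positivity in the matrix algebra M_n(C), that is M = N^* N. *)
Definition positive_mx (C : normedStarAlgType R) n (M : 'M[C]_n) : Prop :=
  exists N : 'M[C]_n, M = \matrix_(i, j) \sum_k star (N k i) ⋆ N k j.

Definition completely_positive (phi : A -> B) : Prop :=
  linear phi /\
  forall n (M : 'M[A]_n), positive_mx M -> positive_mx (map_mx phi M).

Definition contractive (phi : A -> B) : Prop := forall a, `|phi a| <= `|a|.

Definition orthogonal (C : normedStarAlgType R) (a b : C) : Prop :=
  [/\ a ⋆ b = 0, b ⋆ a = 0, star a ⋆ b = 0 & star b ⋆ a = 0].

Definition order_zero (phi : A -> B) : Prop :=
  forall a b, orthogonal a b -> orthogonal (phi a) (phi b).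

Definition is_unit (e : A) : Prop := forall x, e ⋆ x = x /\ x ⋆ e = x.

End Maps.

Section Cosets.
Context {G : groupType}.
Implicit Types (g t : G) (H : set G).

Definition subgroup H : Prop :=
  [/\ H 1%g, forall x y, H x -> H y -> H (x * y)%g & forall x, H x -> H x^-1%g].

Definition lcoset g H : set G := [set (g * h)%g | h in H].

(* The coset space G/H as a set of subsets of G. *)
Definition lcosets H : set (set G) := [set lcoset g H | g in [set: G]].

Definition finite_index H : Prop := finite_set (lcosets H).

Fact lcosets_act_subproof H t (S : lcosets H) :
  lcoset t (val S) \in lcosets H.
Proof.
have [g _ <-] := set_valP S; apply/mem_set; exists (t * g)%g => //.
apply/seteqP; split=> [_ [h Hh <-]|_ [_ [h Hh <-] <-]].
  by exists (g * h)%g; [exists h|rewrite mulgA].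
by exists h => //; rewrite mulgA.
Qed.

Definition lcosets_act H t (S : lcosets H) : lcosets H :=
  exist _ (lcoset t (val S)) (lcosets_act_subproof t S).

End Cosets.

Section CosetAlgebra.
Context {R : realType} {G : groupType} (H : set G).

(* C(G/H).  For H of finite index G/H is finite and discrete, so that all
   functions on it are continuous and bounded. *)
Definition Ccosets : normedStarAlgType R := linfty (lcosets H) (cplx R).

Fact sigma_bounded t (f : Ccosets) :
  (fun S => f (lcosets_act t^-1%g S)) \in bounded_pred.
Proof. by apply/asboolP; exists (rnorm f) => S; exact: sup_norm_ge. Qed.

Definition sigma t (f : Ccosets) : Ccosets := Linfty (sigma_bounded t f).

Fact one_bounded : (fun _ : lcosets H => 1 : cplx R) \in bounded_pred.
Proof. by apply/asboolP; exists (rnorm (1 : cplx R)). Qed.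

Definition Ccosets1 : Ccosets := Linfty one_bounded.

End CosetAlgebra.
Arguments Ccosets R {G} H.
Arguments Ccosets1 R {G} H.

Definition separable_set (T : topologicalType) (D : set T) : Prop :=
  exists S : set T, [/\ countable S, S `<=` D & D `<=` closure S].

Section RokhlinDimension.
Context {R : realType} {G : groupType} {A : cstarAlgType R}.
Variable alpha : cstarAction G A.

(* The sum of the images of 1 being the unit of F(D, A) is stated as the sum being
   a two-sided unit, as units are unique. *)
Definition dim_rok_at_le (H : set G) (d : nat) : Prop :=
  forall (D : starSubalg A) (Dinv : invariant alpha D),
    separable_set (subalg_set D) ->
  exists phi : 'I_d.+1 -> Ccosets R H -> Fcentral D,
    [/\ forall l, completely_positive (phi l),
        forall l, contractive (phi l),
        forall l, order_zero (phi l),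
        forall l t f, phi l (sigma t f) = Fcentral_act Dinv t (phi l f) &
        is_unit (\sum_l phi l (Ccosets1 R H))].

(* Least d >= 0, and +oo if there is none. *)
Definition dim_rok_at (H : set G) : \bar R :=
  ereal_inf [set d%:R%:E | d in dim_rok_at_le H].

Definition dim_rok : \bar R := ereal_sup
  [set dim_rok_at H | H in [set H | subgroup H /\ finite_index H]].

End RokhlinDimension.

Section GroupProperties.
Variable G : groupType.

Definition finitely_generated : Prop := exists S : set G, finite_set S /\
  forall H : set G, subgroup H -> S `<=` H -> H = [set: G].

Definition residually_finite : Prop := forall g : G, g <> 1%g ->
  exists N : set G, [/\ subgroup N, forall x n, N n -> N (x * n * x^-1)%g,
    finite_index N & ~ N g].

(* Existence of a finitely additive left-invariant probability measure on all
   subsets of G. *)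
Definition amenable (R : realType) : Prop := exists mu : set G -> R,
  [/\ forall S, 0 <= mu S, mu [set: G] = 1,
      forall S T, S `&` T = set0 -> mu (S `|` T) = mu S + mu T &
      forall g S, mu (lcoset g S) = mu S].

End GroupProperties.

Section Dimension.
Variables (X : topologicalType).

Definition open_cover (U : set (set X)) : Prop :=
  (forall u, U u -> open u) /\ \bigcup_(u in U) u = [set: X].

Definition refines (V U : set (set X)) : Prop :=
  forall v, V v -> exists2 u, U u & v `<=` u.

(* Every open cover has an open refinement such that each point lies in at most
   n + 1 of its members. *)
Definition cov_dim_le (n : nat) : Prop :=
  forall U, open_cover U -> exists V, [/\ open_cover V, refines V U &
    forall x, ([set v | V v /\ v x] #<= `I_n.+1)%card].

(* In particular the empty space gets dimension 0 instead of -1. *)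
Definition cov_dim (R : realType) : \bar R :=
  ereal_inf [set n%:R%:E | n in cov_dim_le].

End Dimension.

Section C0.
Context {R : realType} (X : topologicalType).

Definition vanishes_at_infinity (f : X -> cplx R) : Prop :=
  forall e : R, 0 < e -> exists2 K : set X, compact K &
    forall x, ~ K x -> rnorm (f x) < e.

Local Notation C0_set := [set f : linfty X (cplx R) |
  continuous (f : X -> cplx R) /\ vanishes_at_infinity f].

Fact C0_closed : closed C0_set.
Proof.
move=> f clf; split=> [x|e e0].
  apply/cvgrPdist_lt => _ /gt0_complexP[e e0 ->].
  have e30 : 0 < e / 3 by rewrite divr_gt0.
  have e30C : 0 < (e / 3)%:C by rewrite ltcR.
  have [g [[gc _]]] := clf _ (nbhsx_ballx f _ e30C).
  rewrite -ball_normE/= rnorm_lt => fg.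
  have fgy y : rnorm (f y - g y) < e / 3.
    exact: le_lt_trans (sup_norm_ge (f - g) y) fg.
  have /cvgrPdist_lt/(_ _ e30C) := gc x; apply: filterS => y.
  rewrite !rnorm_lt => gxy.
  rewrite -(subrKA (g x)) (le_lt_trans (rnormD _ _))//.
  have -> : e = e / 3 + (e / 3 + e / 3) by lra.
  rewrite ltrD// -(subrKA (g y)) (le_lt_trans (rnormD _ _))// ltrD//.
  by rewrite -rnormN opprB.
have e20 : 0 < (e / 2)%:C by rewrite ltcR divr_gt0.
have [g [[_ gv]]] := clf _ (nbhsx_ballx f _ e20).
rewrite -ball_normE/= rnorm_lt => fg.
have [|K cK Kg] := gv (e / 2); first by rewrite divr_gt0.
exists K => // x Kx; rewrite -(subrK (g x) (f x)) (le_lt_trans (rnormD _ _))//.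
rewrite (splitr e) ltrD// ?Kg//.
exact: le_lt_trans (sup_norm_ge (f - g) x) fg.
Qed.

Fact C0_zero : C0_set 0.
Proof.
split; first exact: cst_continuous.
by move=> e e0; exists set0 => [|x _]; [exact: compact0|rewrite rnorm0].
Qed.

Fact C0_add f g : C0_set f -> C0_set g -> C0_set (f + g).
Proof.
move=> [fc fv] [gc gv]; split=> [x|e e0]; first exact: (cvgD (fc x) (gc x)).
have e20 : 0 < e / 2 by rewrite divr_gt0.
have [K cK Kf] := fv _ e20; have [L cL Lg] := gv _ e20.
exists (K `|` L) => [|x /not_orP[Kx Lx]]; first exact: compactU.
rewrite (le_lt_trans (rnormD _ _))// (splitr e) ltrD//; [exact: Kf|exact: Lg].
Qed.

Fact C0_mulr (f g : linfty X (cplx R)) :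
  vanishes_at_infinity g -> vanishes_at_infinity (f ⋆ g).
Proof.
move=> gv e e0.
have f1 : 0 < rnorm f + 1 by rewrite ltr_wpDl// rnorm_ge0.
have [|K cK Kg] := gv (e / (rnorm f + 1)); first by rewrite divr_gt0.
exists K => // x /Kg; rewrite ltr_pdivlMr// mulrC; apply: le_lt_trans.
apply: le_trans (_ : rnorm (f x) * rnorm (g x) <= _).
  by rewrite -lecR rmorphM/= !rnormK norm_smul.
by rewrite ler_wpM2r ?rnorm_ge0// (le_trans (sup_norm_ge f x))// lerDl.
Qed.

Fact C0_mul f g : C0_set f -> C0_set g -> C0_set (f ⋆ g).
Proof.
move=> [fc _] [gc gv]; split; last exact: C0_mulr.
by move=> x; exact: (@cvgM R[i] _ _ _ (f : X -> R[i]^o) g _ _ (fc x) (gc x)).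
Qed.

Fact C0_scale (a : R[i]) f : C0_set f -> C0_set (a *: f).
Proof.
move=> [fc fv]; split; first by move=> x; exact: (cvgZl_tmp (fc x)).
have ab : (fun _ : X => a : cplx R) \in bounded_pred.
  by apply/asboolP; exists (rnorm (a : cplx R)).
exact: (@C0_mulr (Linfty ab)).
Qed.

Fact C0_star f : C0_set f -> C0_set (star f).
Proof.
move=> [fc fv]; split=> [x|e /fv[K cK Kf]].
  exact: (continuous_comp (fc x) (@star_continuous _ (cplx R) _)).
by exists K => // x /Kf; rewrite /rnorm norm_star.
Qed.

Definition C0 : starSubalg (linfty X (cplx R)) :=
  StarSubalg C0_closed C0_zero C0_add C0_scale C0_mul C0_star.

End C0.
Arguments C0 : clear implicits.

(* Actions by homeomorphisms; the inverse of act g is act g^-1. *)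
Record topAction (G : groupType) (X : topologicalType) := {
  tact :> G -> X -> X;
  tact1 : forall x, tact 1%g x = x;
  tactM : forall g h x, tact (g * h)%g x = tact g (tact h x);
  tact_continuous : forall g, continuous (tact g)
}.

Section TopAction.
Context {G : groupType} {X : topologicalType} (act : topAction G X).

Definition free_action : Prop := forall g x, act g x = x -> g = 1%g.

Definition proper_action : Prop := forall K : set X, compact K ->
  finite_set [set g | act g @` K `&` K !=set0].

Context {R : realType}.
Local Notation A := (C0 R X).

Fact C0_act_bounded g (f : A) :
  (fun x => subalg_val f (act g^-1%g x)) \in bounded_pred.
Proof.
by apply/asboolP; exists (rnorm (subalg_val f)) => x; exact: sup_norm_ge.
Qed.

Fact C0_act_subproof g (f : A) : subalg_set A (Linfty (C0_act_bounded g f)).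
Proof.
have [fc fv] := subalg_valP f; split=> [x|e /fv[K cK Kf]].
  exact: (continuous_comp (@tact_continuous _ _ act _ x) (fc _)).
exists (act g @` K) => [|x nKx].
  apply: continuous_compact cK; apply: continuous_subspaceT.
  exact: tact_continuous.
apply: Kf => Kx; apply: nKx; exists (act g^-1%g x) => //.
by rewrite -tactM mulgV tact1.
Qed.

Definition C0_act g (f : A) : A := subalg_of A (C0_act_subproof g f).

Fact C0P (f h : A) : subalg_val f =1 subalg_val h -> f = h.
Proof. by move=> fh; apply/val_inj/linftyP. Qed.

Lemma C0_actE g f x : subalg_val (C0_act g f) x = subalg_val f (act g^-1%g x).
Proof. by []. Qed.

Fact C0_act1 f : C0_act 1%g f = f.
Proof. by apply: C0P => x /=; rewrite invg1 tact1. Qed.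
Fact C0_actG g h f : C0_act (g * h)%g f = C0_act g (C0_act h f).
Proof. by apply: C0P => x /=; rewrite invgM tactM. Qed.
Fact C0_actD g f h : C0_act g (f + h) = C0_act g f + C0_act g h.
Proof. by apply: C0P => x; rewrite subalg_valD linftyDE !C0_actE subalg_valD linftyDE. Qed.
Fact C0_actZ g (c : R[i]) f : C0_act g (c *: f) = c *: C0_act g f.
Proof. by apply: C0P => x; rewrite subalg_valZ linftyZE !C0_actE subalg_valZ linftyZE. Qed.
Fact C0_actM g f h : C0_act g (f ⋆ h) = C0_act g f ⋆ C0_act g h.
Proof. by apply: C0P => x; rewrite subalg_valM linftyME !C0_actE subalg_valM linftyME. Qed.
Fact C0_act_star g f : C0_act g (star f) = star (C0_act g f).
Proof. by apply: C0P => x; rewrite subalg_val_star linfty_starE !C0_actE subalg_val_star linfty_starE. Qed.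
Fact C0_act_norm g f : `|C0_act g f| = `|f|.
Proof.
have le h k : rnorm (subalg_val (C0_act h k)) <= rnorm (subalg_val k).
  apply: sup_norm_le => [|x]; first exact: rnorm_ge0.
  by rewrite C0_actE; exact: (sup_norm_ge (subalg_val k)).
rewrite -[LHS](rnormK (subalg_val _)) -[RHS](rnormK (subalg_val f)).
congr (_%:C); apply/eqP; rewrite eq_le le/=.
by rewrite -{1}[f]C0_act1 -(mulVg g) C0_actG le.
Qed.

Definition C0_action : cstarAction G (subalg A) := {|
  aut1 := C0_act1; autG := C0_actG; autD := C0_actD; autZ := C0_actZ;
  autM := C0_actM; aut_star := C0_act_star; aut_norm := C0_act_norm |}.

End TopAction.

(* Main.v *)
(* The action being free and proper, X is covered by countably many relatively
   compact open slices (sets with pairwise disjoint translates), and the locally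
   finite sum theorem for dim, carried out on saturations of slices, gives an
   open cover of X by G-invariant sets U_i, each mapped equivariantly and
   continuously to G, of order at most dim X + 1.  Take invariant functions p_i
   with U_i = {p_i > 0}.  The points at which some l + 1 of the p_i strictly
   dominate all the others form an invariant open set, disjointly indexed by the
   dominating families, hence again with an equivariant continuous map s_l to G;
   here l runs over 0, ..., dim X.  From the gaps one gets invariant functions
   k_l >= 0 supported there with sum_l k_l^2 = 1.  If u_m is an approximate unit
   of C_0(X), then f |-> [(u_m^2 k_l^2 (f o s_l))_m], for 0 <= l <= dim X, are
   the required order zero maps C(G/H) -> F(D, C_0(X)). *)
Require Import Defs.
From HB Require Import structures.
From mathcomp Require Import all_boot all_order all_algebra finmap monoid.
From mathcomp Require Import all_classical all_reals topology normedtype ereal.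
From mathcomp Require Import realfun lra complex.
Set Implicit Arguments.
Unset Strict Implicit.
Unset Printing Implicit Defensive.
Import Order.TTheory GRing.Theory Num.Theory.
Import numFieldNormedType.Exports.

Local Open Scope classical_set_scope.
Local Open Scope ring_scope.

Lemma finite_near (I : choiceType) (T : Type) (F : set_system T) (D : set I)
    (P : I -> T -> Prop) : Filter F -> finite_set D ->
  (forall i, D i -> \forall x \near F, P i x) ->
  \forall x \near F, forall i, D i -> P i x.
Proof.
move=> FF fD DP.
have : F (\bigcap_(i in [set` fset_set D]) P i).
  by apply: filter_bigI => i; rewrite in_fset_set// inE; exact: DP.
by apply: filterS => x Px i Di; apply: Px; rewrite /= in_fset_set// inE.
Qed.

(** * Slices and saturations *)

Section OrbitGeometry.
Context {R : realType} {G : groupType} {X : metricType R} (act : topAction G X).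
Implicit Types (A C K : set X) (x : X) (g : G).

Definition slice A := forall g x, A x -> A (act g x) -> g = 1%g.

Definition saturation A : set X := [set x | exists g, A (act g x)].

Lemma saturationJ A g x : saturation A (act g x) <-> saturation A x.
Proof.
split=> -[h Ahx]; first by exists (h * g)%g; rewrite tactM.
by exists (h * g^-1)%g; rewrite tactM -(tactM act g^-1%g) mulVg tact1.
Qed.

Lemma open_saturation A : open A -> open (saturation A).
Proof.
move=> Ao; have -> : saturation A = \bigcup_g (act g @^-1` A).
  by apply/seteqP; split=> x [g]; [exists g|move=> _; exists g].
apply: bigcup_open => g _; apply: open_comp => // x _.
exact: tact_continuous.
Qed.

Hypothesis lc : locally_compact [set: X].
Hypothesis proper : proper_action act.

Lemma compact_nbhs x : exists2 K, compact K & nbhs x K.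
Proof.
have [K xK [cK _]] := lc (I : [set: X] x); exists K => //.
by move: xK; rewrite /within/=; apply: filterS => y /(_ I).
Qed.

(** If [L] is a compact neighbourhood of [x] and [g] carries a point of [L] into [K], then [g]
    carries a point of the compact union of [K] and [L] back into it; properness leaves finitely
    many such [g]. *)
Lemma proper_locally_finite K x : compact K -> exists2 D : set G, finite_set D &
  \forall y \near x, forall g, K (act g y) -> D g.
Proof.
move=> cK; have [L cL xL] := compact_nbhs x.
exists [set g | act g @` (K `|` L) `&` (K `|` L) !=set0].
  exact/proper/compactU.
apply: filterS xL => y Ly g Kgy; exists (act g y).
by split; [exists y => //; right|left].
Qed.

(** Near [x] only finitely many [g] can reach [K], so avoiding [C] along the whole orbit is a finite
    intersection of open conditions. *)
Lemma closed_saturation C K : compact K -> C `<=` K -> closed C ->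
  closed (saturation C).
Proof.
move=> cK CK Cc; rewrite -openC openE => x /= nCx.
have [D fD Dx] := proper_locally_finite x cK.
have : \forall y \near x, forall g, D g -> ~ C (act g y).
  apply: finite_near => // g _.
  apply: (@tact_continuous _ _ act g x (~` C)); apply: open_nbhs_nbhs.
  by split; [rewrite openC|move=> Cgx; apply: nCx; exists g].
apply: filter_app; apply: filterS Dx => y Dy nCy [g Cgy].
by apply: (nCy g) => //; apply/Dy/CK.
Qed.

Lemma closed_mball (x : X) (r : R) : closed [set y | mdist x y <= r].
Proof.
rewrite -openC openE => y /= /negP; rewrite -ltNge => ry.
apply/nbhs_ballP; exists (mdist x y - r) => /=; first by rewrite subr_gt0.
move=> z; rewrite ballEmdist/= => yz; apply/negP; rewrite -ltNge.
by have := metric_triangle x z y; rewrite (metric_sym z y); lra.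
Qed.

Lemma open_mball (x : X) (r : R) : open [set y | mdist x y < r].
Proof.
rewrite openE => y /= xy; apply/nbhs_ballP; exists (r - mdist x y) => /=.
  by rewrite subr_gt0.
move=> z; rewrite ballEmdist/= => yz.
have := metric_triangle x y z; lra.
Qed.

Hypothesis free : free_action act.

(** Properness leaves finitely many [g] to exclude near [x], and freeness separates [act g x] from
    [x] for each of them. *)
Lemma slice_nbhs x : exists2 K, nbhs x K & compact K /\ slice K.
Proof.
have [L cL xL] := compact_nbhs x; have [D fD Dx] := proper_locally_finite x cL.
(* If these bounds held at both [y] and [act g y], the triangle inequality through [act g y] would
   bound [mdist (act g x) x] strictly by itself. *)
have : \forall y \near x, forall g, (D `\ 1%g) g ->
    mdist (act g x) (act g y) < mdist (act g x) x / 2 /\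
    mdist x y < mdist (act g x) x / 2.
  apply: finite_near => [|g [_ g1]]; first exact: finite_setD.
  have e0 : 0 < mdist (act g x) x / 2.
    by rewrite divr_gt0// mdist_gt0; apply/eqP => /free.
  have := @tact_continuous _ _ act g x _ (nbhsx_ballx (act g x) _ e0).
  apply: filterS2 (nbhsx_ballx x _ e0) => y.
  by rewrite /= !ballEmdist.
move/(filterI xL)/(filterI Dx) => /nbhs_ballP[r /= r0 xr].
have rh : 0 < r / 2 by rewrite divr_gt0.
have sub y : mdist x y <= r / 2 -> ball x r y.
  by rewrite ballEmdist/= => /le_lt_trans; apply; lra.
exists [set y | mdist x y <= r / 2].
  by apply: filterS (nbhsx_ballx x _ rh) => y; rewrite ballEmdist/= => /ltW.
split; first apply: (subclosed_compact _ cL).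
- exact: closed_mball.
- by move=> y /sub/xr[_ []].
move=> g y /= /sub xy /sub gxy; apply: contrapT => g1.
have [Dy [Ly sy]] := xr _ xy; have [_ [Lgy sgy]] := xr _ gxy.
have Dg := Dy _ Lgy.
have [s1 _] := sy g (conj Dg g1); have [_ s2] := sgy g (conj Dg g1).
have := metric_triangle (act g x) (act g y) x.
by rewrite (metric_sym (act g y) x); lra.
Qed.

(** A Lindelöf argument: balls of radius [1/(n+1)] about points of a countable dense set, kept only
    if they fit in a compact slice, cover [X]. *)
Lemma countable_slices : separable_set [set: X] ->
  exists K V : nat -> set X, [/\ forall i, compact (K i), forall i, slice (K i),
    forall i, open (V i), forall i, V i `<=` K i & forall x, exists i, V i x].
Proof.
move=> [S [/pcard_leP/unsquash f _ Sd]].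
(* [i] codes a centre and a radius; a non-code defaults to [(0, 0)], which at worst repeats a ball.
   As [f] is injective on [S], the union [B i] has at most one member. *)
pose c (i : nat) : nat * nat := odflt (0, 0)%N (choice.unpickle i).
pose B i := \bigcup_(y in [set y | S y /\ f y = (c i).1])
  [set z | mdist y z < (c i).2.+1%:R^-1].
pose P i (K : set X) := [/\ compact K, slice K & B i `<=` K].
pose K i := xget set0 (P i).
pose V i := if pselect (exists L, P i L) then B i else set0.
have KP i : (P i (K i) /\ exists L, P i L) \/ (K i = set0 /\ ~ exists L, P i L).
  by rewrite /K; case: xgetP => [L _ PL|nP]; [left; split=> //; exists L|
    right; split=> // -[L /nP]].
exists K, V; split.
- by move=> i; case: (KP i) => [[[]]//|[-> _]]; exact: compact0.
- move=> i; case: (KP i) => [[[_ sK _] _]|[K0 _]]; first exact: sK.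
  by move=> g y; rewrite K0.
- move=> i; rewrite /V; case: pselect => [?|?]; last exact: open0.
  by apply: bigcup_open => y _; exact: open_mball.
- move=> i; rewrite /V; case: pselect => [eP y|? y []].
  by case: (KP i) => [[[_ _ sub] _]|[_ /(_ eP)//]]; exact: sub.
move=> x; have [L xL [cL sL]] := slice_nbhs x.
have [e /= e0 xe] := (nbhs_ballP x L).1 xL.
pose n := Num.truncn (2 / e).
have ne : n.+1%:R^-1 < e / 2.
  rewrite -[ltRHS]invrK ltf_pV2 ?posrE ?invr_gt0 ?divr_gt0//.
  by rewrite invf_div truncnS_gt.
have n0 : 0 < n.+1%:R^-1 :> R by rewrite invr_gt0.
have [y [Sy]] := Sd x I _ (nbhsx_ballx x _ n0); rewrite ballEmdist/= => xy.
have PiL : P (choice.pickle (f y, n)) L.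
  split=> // z; rewrite /B /c choice.pickleK/= => -[y' [Sy' fy'] /= yz].
  have {fy'}y'y : y' = y by apply: (@inj _ _ _ f) => //; exact/mem_set.
  apply: xe; rewrite ballEmdist/=; move: yz; rewrite y'y => yz.
  apply: le_lt_trans (metric_triangle x y z) _.
  by rewrite (splitr e) ltrD// (lt_trans _ ne).
exists (choice.pickle (f y, n)); rewrite /V; case: pselect => [?|[]]; last by exists L.
by exists y; rewrite /c choice.pickleK//= metric_sym.
Qed.

End OrbitGeometry.

(** * Invariant covers of finite order *)

(** Indices are counted, so coinciding members of the family count separately. *)
Definition order_le (X : Type) (U : nat -> set X) (n : nat) (x : X) : Prop :=
  forall S : {fset nat}, (forall i, i \in S -> U i x) -> (#|` S| <= n.+1)%N.

(** Each member of a refinement is assigned to one [U i] containing it, and members with the same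
    index are united; a point then meets no more indices than it met members. *)
Lemma cov_dim_le_indexed (X : topologicalType) n (U : nat -> set X) :
  cov_dim_le X n -> (forall i, open (U i)) -> (forall x, exists i, U i x) ->
  exists O : nat -> set X, [/\ forall i, open (O i), forall i, O i `<=` U i,
    forall x, exists i, O i x & forall x, order_le O n x].
Proof.
move=> dimX Uo Uc; have [] := dimX (range U).
  split=> [_ [i _ <-]//|]; rewrite -subTset => x _.
  by have [i Ux] := Uc x; exists (U i) => //; exists i.
move=> V [[Vo Vc] VU Vn]; pose idx v := xget 0%N [set i | v `<=` U i].
have idxP v : V v -> v `<=` U (idx v).
  by move=> /VU[_ [i _ <-] vU]; rewrite /idx; case: xgetP => [j _//|/(_ i)/(_ vU)].
exists (fun i => \bigcup_(v in [set v | V v /\ idx v = i]) v); split.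
- by move=> i; apply: bigcup_open => v [Vv _]; exact: Vo.
- by move=> i x [v [Vv <-] vx]; exact: idxP vx.
- move=> x; have [v Vv vx] : (\bigcup_(u in V) u) x by rewrite Vc.
  by exists (idx v); exists v.
move=> x S SO; rewrite -[S]set_fsetK; apply: geq_card_fset_set.
apply: card_le_trans (Vn x); apply: card_le_trans (card_image_le idx _).
by apply: subset_card_le => i /SO[v [Vv <-] vx]; exists v.
Qed.

Section InvariantCover.
Context {R : realType} {G : groupType} {X : metricType R} (act : topAction G X).
Hypotheses (lc : locally_compact [set: X]) (proper : proper_action act).
Variables (n : nat) (K V : nat -> set X).
Hypotheses (dimX : cov_dim_le X n) (Kc : forall i, compact (K i))
  (Ks : forall i, slice act (K i)) (Vo : forall i, open (V i))
  (VK : forall i, V i `<=` K i) (Vc : forall x, exists i, V i x).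
Local Notation sat := (saturation act).

Let good (U : nat -> set X) := [/\ forall i, open (U i),
  forall i g x, U i (act g x) <-> U i x & forall x, exists i, U i x].

(* Removing from [U i] the saturation of [F `\` O i] only discards points of the
   saturation of [F], on which the cover inherits the order of [O]. *)
Let trim (F : set X) (O U : nat -> set X) i := U i `\` sat (F `\` O i).

Let F m := K m `\` \bigcup_(j in `I_m) sat (V j).

Let F_closed m : closed (F m).
Proof.
rewrite /F setDE; apply: closedI.
  by apply: compact_closed; [exact: metric_hausdorff|exact (@Kc m)].
apply: open_closedC; apply: bigcup_open => j _; exact: open_saturation.
Qed.

(** The trimmed sets still cover: if the orbit of [x] meets [F m], it does so in one point, [K m]
    being a slice, and any [O i] containing that point keeps [x] in the [i]-th set. *)
Let trim_good m O U : good U -> (forall i, open (O i)) ->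
  (forall i, O i `<=` U i) -> (forall x, exists i, O i x) ->
  good (trim (F m) O U).
Proof.
move=> [Uo Ui Uc] Oo OU Oc; split.
- move=> i; rewrite /trim setDE; apply: openI => //; apply: closed_openC.
  apply: (closed_saturation lc proper (@Kc m)); first by move=> x [[]].
  by rewrite setDE; apply: closedI => //; exact: open_closedC.
- by move=> i g x; rewrite /trim /setD/= Ui saturationJ.
move=> x; have [[g Fgx]|nF] := pselect (sat (F m) x); last first.
  have [i Ux] := Uc x; exists i; split=> // -[g [Fgx _]].
  by apply: nF; exists g.
have [i Ogx] := Oc (act g x); exists i; split; first exact/(Ui i g)/OU.
move=> [h [Fhx]]; have hg : (h * g^-1)%g = 1%g.
  apply: (Ks (proj1 Fgx)).
  by rewrite tactM -(tactM act g^-1%g) mulVg tact1; case: Fhx.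
by apply; rewrite -(divgK g h) hg mul1g.
Qed.

Let trim_order m O U x : (forall y, order_le O n y) -> sat (F m) x ->
  order_le (trim (F m) O U) n x.
Proof.
move=> On [g Fgx] S SU; apply: (On (act g x)) => i /SU[_ nO].
by apply: contrapT => nOgx; apply: nO; exists g.
Qed.

(* The sets [F m] are slices with a locally finite family of saturations which
   cover X, since [sat (V j)] misses [F m] for m > j.  Trimming along [F 0],
   [F 1], ... is therefore locally a finite process. *)
Lemma invariant_cover : exists U : nat -> set X, [/\
  forall i, open (U i), forall i g x, U i (act g x) <-> U i x,
  forall i, U i `<=` sat (V i), forall x, exists i, U i x &
  forall x, order_le U n x].
Proof.
have /choice[O OP] U : exists O : nat -> set X, good U ->
    [/\ forall i, open (O i), forall i, O i `<=` U i,
      forall x, exists i, O i x & forall x, order_le O n x].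
  have [[Uo Ui Uc]|nU] := pselect (good U); last by exists U => /nU.
  by have [O] := cov_dim_le_indexed dimX Uo Uc; exists O.
pose fix u m : nat -> set X :=
  if m is m'.+1 then trim (F m') (O (u m')) (u m') else fun i => sat (V i).
have ug m : good (u m).
  elim: m => [|m IH]; last by have [? ? ? ?] := OP _ IH; exact: trim_good.
  split=> [i|i g x|x]; [exact: open_saturation|exact: saturationJ|].
  by have [i Vx] := Vc x; exists i, 1%g; rewrite tact1.
have uS m i : u m.+1 i `<=` u m i by move=> x [].
have uleq m m' i : (m <= m')%N -> u m' i `<=` u m i.
  elim: m' => [|m' IH]; first by rewrite leqn0 => /eqP->.
  rewrite leq_eqVlt => /predU1P[->//|]; rewrite ltnS => /IH mm'.
  exact: subset_trans (@uS m' i) mm'.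
(* [u j.+1] has been trimmed along [F 0], ..., [F j], and the later [F m] miss [sat (V j)]: there
   the sequence is constant from stage [j.+1] on. *)
have ustable j i x : sat (V j) x -> u j.+1 i x -> forall m, u m i x.
  move=> Vjx uj m; have [mj|] := leqP m j.+1; first exact: uleq uj.
  elim: m => // m IH jm; have [jm'|mj] := ltnP j.+1 m.
    split; first exact: IH.
    by move=> [g [[_ /= nV] _]]; apply: nV; exists j => /=;
      [rewrite (ltn_trans _ jm')|rewrite saturationJ].
  split; first exact: uleq uj.
  by move=> [g [[_ nV] _]]; apply: nV; exists j => //; rewrite saturationJ.
exists (fun i => \bigcap_m u m i); split.
- move=> i; rewrite openE => x Ux; have [j Vx] := Vc x.
  have jx : sat (V j) x by exists 1%g; rewrite tact1.
  have [uo _ _] := ug j.+1.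
  have nVj : nbhs x (sat (V j)) by apply: open_nbhs_nbhs; split=> //; exact: open_saturation.
  have nuj : nbhs x (u j.+1 i) by apply: open_nbhs_nbhs; split=> //; exact: Ux.
  by apply: filterS2 nVj nuj => y yV yu m _; exact: ustable yV yu m.
- by move=> i g x; split=> Ux m _; have [_ ui _] := ug m; apply/ui; exact: Ux.
- by move=> i x /(_ 0%N I).
- move=> x; have [j Vx] := Vc x; have [_ _ /(_ x)[i ux]] := ug j.+1.
  by exists i => m _; apply: ustable ux m; exists 1%g; rewrite tact1.
(* For the least [j] with [x] in [sat (V j)], [x] lies in [sat (F j)], so the trim along [F j]
   bounds the order at [x]. *)
move=> x; have exj : exists j, `[< sat (V j) x >].
  by have [j Vx] := Vc x; exists j; apply/asboolP; exists 1%g; rewrite tact1.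
have [j /asboolP[g Vgx] jmin] := ex_minnP exj.
have Fx : sat (F j) x.
  exists g; split; first exact: VK.
  move=> [i /= ij]; rewrite saturationJ => /asboolP/jmin.
  by rewrite leqNgt ij.
have [_ _ _ On] := OP _ (ug j).
move=> S SU; apply: (trim_order (U := u j) On Fx) => i /SU Ux.
exact: (Ux j.+1 I).
Qed.

End InvariantCover.

(** * Invariant partitions and Rokhlin towers *)

Section Bump.
Context {R : realType} {X : metricType R} (c : R) (W : set X).

(** The minimum of [c] and the distance to the complement of [W]; adjoining [c] covers the case of
    an empty complement. *)
Definition bump (x : X) : R := inf (c |` [set mdist x y | y in ~` W]).

Hypothesis c0 : 0 < c.

Let has_lb x : has_lbound (c |` [set mdist x y | y in ~` W]).
Proof. by exists 0 => _ [->|[y _ <-]]; [exact: ltW|exact: mdist_ge0]. Qed.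

Lemma bump_ge0 x : 0 <= bump x.
Proof.
apply: lb_le_inf; first by exists c; left.
by move=> _ [->|[y _ <-]]; [exact: ltW|exact: mdist_ge0].
Qed.

Lemma bump_le x : bump x <= c.
Proof. by apply: ge_inf => //; left. Qed.

Lemma bump_eq0 x : ~ W x -> bump x = 0.
Proof.
move=> Wx; apply/eqP; rewrite eq_le bump_ge0 andbT -(mdistxx x).
by apply: ge_inf => //; right; exists x.
Qed.

Lemma bump_gt0 x : open W -> W x -> 0 < bump x.
Proof.
move=> Wo Wx; have /nbhs_ballP[r /= r0 rW] : nbhs x W by exact: open_nbhs_nbhs.
apply: lt_le_trans (_ : Num.min c r <= _); first by rewrite lt_min c0.
apply: lb_le_inf; first by exists c; left.
move=> _ [->|[y Wy <-]]; first by rewrite ge_min lexx.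
rewrite ge_min; apply/orP; right; rewrite leNgt; apply/negP => xy.
by apply: Wy; apply: rW; rewrite ballEmdist.
Qed.

Lemma bump_lipschitz x y : bump x <= bump y + mdist x y.
Proof.
rewrite -lerBlDr; apply: lb_le_inf; first by exists c; left.
move=> _ [->|[z Wz <-]]; rewrite lerBlDr.
  by rewrite (le_trans (bump_le x))// lerDl mdist_ge0.
apply: le_trans (_ : mdist x z <= _); last by rewrite addrC metric_triangle.
by apply: ge_inf => //; right; exists z.
Qed.

Lemma bump_continuous x (e : R) : 0 < e ->
  \forall y \near x, `|bump y - bump x| < e.
Proof.
move=> e0; apply: filterS (nbhsx_ballx x _ e0) => y.
rewrite ballEmdist/= => xy.
have := bump_lipschitz x y; have := bump_lipschitz y x.
by rewrite (metric_sym y x) ltr_norml; lra.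
Qed.

End Bump.

Section InvariantBump.
Context {R : realType} {G : groupType} {X : metricType R} (act : topAction G X).
Hypotheses (lc : locally_compact [set: X]) (proper : proper_action act).
Variables (c : R) (K W : set X).
Hypotheses (c0 : 0 < c) (Kc : compact K) (Ks : slice act K) (Wo : open W)
  (WK : W `<=` K).

(** [p] is the maximum of [bump c W] over the orbit. It is attained because [W] lies in a slice, so
    at most one point of an orbit has a nonzero value. Properness makes the maximum locally one over
    finitely many [g]. *)
Lemma invariant_bump : exists p : X -> R, [/\ forall x, 0 <= p x <= c,
  forall g x, p (act g x) = p x, forall x, 0 < p x <-> saturation act W x &
  forall x e, 0 < e -> \forall y \near x, `|p y - p x| < e].
Proof.
have /choice[p pP] x : exists r, (forall g, bump c W (act g x) <= r) /\
    (exists g, r = bump c W (act g x)).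
  have [[g Wgx]|nW] := pselect (exists g, W (act g x)); last first.
    exists (bump c W (act 1%g x)); split; last by exists 1%g.
    by move=> g; rewrite !bump_eq0// => Wgx; apply: nW; [exists 1%g|exists g].
  exists (bump c W (act g x)); split; last by exists g.
  move=> h; have [Whx|nWhx] := pselect (W (act h x)); last first.
    by rewrite (bump_eq0 c0 nWhx) bump_ge0.
  suff -> : h = g by [].
  have /Ks : K (act g x) by exact: WK.
  move=> /(_ (h * g^-1)%g); rewrite -tactM divgK => /(_ (WK Whx)) hg.
  by rewrite -(divgK g h) hg mul1g.
have ple g x : bump c W (act g x) <= p x by have [] := pP x.
have pex x : exists g, p x = bump c W (act g x) by have [] := pP x.
exists p; split.
- by move=> x; have [g ->] := pex x; rewrite bump_ge0// bump_le.
- move=> g x; apply/eqP; rewrite eq_le; apply/andP; split.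
    by have [h ->] := pex (act g x); rewrite -tactM ple.
  by have [h ->] := pex x; rewrite -(divgK g h) tactM ple.
- move=> x; split=> [px|[g Wgx]].
    have [g pg] := pex x; exists g; apply: contrapT => /(bump_eq0 c0) W0.
    by move: px; rewrite pg W0 ltxx.
  by apply: lt_le_trans (ple g x); exact: bump_gt0.
move=> x e e0.
have [D fD Dx] := proper_locally_finite lc proper x Kc.
have Dnear : \forall y \near x, forall g, D g ->
    `|bump c W (act g y) - bump c W (act g x)| < e.
  apply: finite_near => // g _.
  exact: (@tact_continuous _ _ act g x _ (bump_continuous W c0 (act g x) e0)).
have Dx' := nbhs_singleton Dx.
apply: filterS2 Dx Dnear => y Dy /= De.
have {}De g : `|bump c W (act g y) - bump c W (act g x)| < e.
  have [/De//|nD] := pselect (D g).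
  rewrite !(@bump_eq0 _ _ c W)// ?subrr ?normr0//; first by move=> /WK/Dx'.
  by move=> /WK/Dy.
(* The maxima at [y] and [x] may be attained at different [g] and [h]; each is compared with the
   value at the other point along the same group element. *)
have [g pg] := pex y; have [h ph] := pex x.
have := De g; have := De h; have := ple g x; have := ple h y.
by rewrite !ltr_norml; lra.
Qed.

End InvariantBump.

(** * Gaps between the largest values of a sequence *)

Section TopGap.
Context {R : realType}.
Implicit Types (f : nat -> R) (l : nat) (S : {fset nat}) (t : R).

Definition gap f l t S : Prop := #|` S| = l.+1 /\
  forall i j, i \in S -> j \notin S -> t <= f i - f j.

(* For [f] in [0, 1] tending to [0], the difference between the [l+1]-st and the
   [l+2]-nd largest values of [f]. *)
Definition topgap l f : R := sup (0 |` [set t | exists S, gap f l t S]).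

Lemma fset_infinite S : exists j, j \notin S.
Proof.
apply: contrapT => nS; apply: infinite_nat.
apply: sub_finite_set (finite_fset S) => j _ /=.
by apply: contrapT => jS; apply: nS; exists j; apply/negP.
Qed.

Lemma gap_le1 f l t S : (forall i, 0 <= f i <= 1) -> gap f l t S -> t <= 1.
Proof.
move=> f01 [Sl fS]; have [i iS] : exists i, i \in S.
  by apply/fset0Pn; rewrite -cardfs_gt0 Sl.
have [j jS] := fset_infinite S.
have := fS i j iS jS; have := f01 i; have := f01 j; lra.
Qed.

Lemma topgap_ge f l t S : (forall i, 0 <= f i <= 1) -> gap f l t S ->
  t <= topgap l f.
Proof.
move=> f01 g; apply: ub_le_sup; last by right; exists S.
by exists 1 => t' [->|[S' /(gap_le1 f01)]].
Qed.

Lemma topgap_ge0 f l : (forall i, 0 <= f i <= 1) -> 0 <= topgap l f.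
Proof.
move=> f01; apply: ub_le_sup; last by left.
by exists 1 => t' [->|[S' /(gap_le1 f01)]].
Qed.

Lemma topgap_gt0 f l : 0 < topgap l f -> exists2 t, 0 < t & exists S, gap f l t S.
Proof.
have n0 : (0 |` [set t | exists S, gap f l t S]) !=set0 by exists 0; left.
move=> /(sup_gt n0)[t [->|[S g]] t0]; first by rewrite ltxx in t0.
by exists t => //; exists S.
Qed.

(** Otherwise equal cardinality gives [i] in [S] only and [j] in [S'] only, and the two gaps yield
    [f i > f j > f i]. *)
Lemma gap_uniq f l t t' S S' : 0 < t -> 0 < t' ->
  gap f l t S -> gap f l t' S' -> S = S'.
Proof.
move=> t0 t'0 [Sl fS] [S'l fS']; apply: contrapT => SS'.
have ex (A B : {fset nat}) : #|` A| = #|` B| -> A <> B -> exists2 i, i \in A & i \notin B.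
  move=> AB nAB; apply: contrapT => nex; apply: nAB; apply/eqP.
  rewrite eqEfcard AB leqnn andbT; apply/fsubsetP => i iA.
  by apply: contrapT => /negP iB; apply: nex; exists i.
have [i iS iS'] := ex S S' (etrans Sl (esym S'l)) SS'.
have [j jS' jS] := ex S' S (etrans S'l (esym Sl)) (nesym SS').
have := fS i j iS jS; have := fS' j i jS' iS'; lra.
Qed.

Lemma gap_perturb f f' l t e S : (forall i, `|f' i - f i| <= e) ->
  gap f l t S -> gap f' l (t - 2 * e) S.
Proof.
move=> fe [Sl fS]; split=> // i j iS jS; have := fS i j iS jS.
by have := fe i; have := fe j; rewrite !ler_norml; lra.
Qed.

Lemma topgap_perturb f f' l e : (forall i, 0 <= f i <= 1) ->
  (forall i, 0 <= f' i <= 1) -> (forall i, `|f' i - f i| <= e) ->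
  `|topgap l f' - topgap l f| <= 2 * e.
Proof.
move=> f01 f'01 fe.
have key h h' : (forall i, 0 <= h i <= 1) -> (forall i, 0 <= h' i <= 1) ->
    (forall i, `|h' i - h i| <= e) -> topgap l h <= topgap l h' + 2 * e.
  move=> h01 h'01 he; apply: ge_sup; first by exists 0; left.
  move=> t [->|[S /(gap_perturb he)/(topgap_ge h'01)]]; last by lra.
  by have := topgap_ge0 l h'01; have := he 0%N; rewrite ler_norml; lra.
have fe' i : `|f i - f' i| <= e by rewrite distrC.
have := key _ _ f01 f'01 fe; have := key _ _ f'01 f01 fe'.
by rewrite ler_norml; lra.
Qed.

(** The least positive value is a gap below [S]. With the order bound on the cover this makes the
    sum of the gaps positive everywhere. *)
Lemma topgap_support f l S : (forall i, 0 <= f i <= 1) -> #|` S| = l.+1 ->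
  (forall i, 0 < f i <-> i \in S) -> 0 < topgap l f.
Proof.
move=> f01 Sl fS; pose m := \big[Num.min/1]_(i <- S) f i.
have m0 : 0 < m.
  by rewrite /m big_seq; elim/big_ind: _ => // [x y|i /fS//]; rewrite lt_min => -> ->.
apply: lt_le_trans m0 (topgap_ge (S := S) f01 _); split=> // i j iS jS.
have -> : f j = 0.
  apply/eqP; rewrite eq_le; have /andP[-> _] := f01 j; rewrite andbT leNgt.
  by apply/negP => /fS; exact/negP.
by rewrite subr0 /m; exact: ge_bigmin_seq.
Qed.

End TopGap.

Lemma continuous_sum (R : numFieldType) (T : topologicalType) (I : Type)
    (r : seq I) (h : I -> T -> R) : (forall i, continuous (h i)) ->
  continuous (fun x => \sum_(i <- r) h i x).
Proof.
move=> hc; elim: r => [|i r IH].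
  by under eq_fun do rewrite big_nil; exact: cst_continuous.
under eq_fun do rewrite big_cons; move=> x.
by apply: cvgD; [exact: hc|exact: IH].
Qed.

(** * Equivariant maps to the group built from the gaps *)

Section Towers.
Context {R : realType} {G : groupType} {X : metricType R} (act : topAction G X).
Hypotheses (lc : locally_compact [set: X]) (proper : proper_action act).
Variables (n : nat) (K V : nat -> set X).
Hypotheses (dimX : cov_dim_le X n) (Kc : forall i, compact (K i))
  (Ks : forall i, slice act (K i)) (Vo : forall i, open (V i))
  (VK : forall i, V i `<=` K i) (Vc : forall x, exists i, V i x).

Lemma rokhlin_towers : exists (k : 'I_n.+1 -> X -> R) (s : 'I_n.+1 -> X -> G),
  [/\ forall l x, 0 <= k l x /\ \sum_l' k l' x ^+ 2 = 1,
      forall l, continuous (k l),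
      forall l g x, k l (act g x) = k l x,
      forall l x, k l x != 0 -> forall g, s l (act g x) = (g * s l x)%g &
      forall l x, k l x != 0 -> \forall y \near x, s l y = s l x].
Proof.
have [U [Uo Ui UV Uc Un]] := invariant_cover lc proper dimX Kc Ks Vo VK Vc.
pose W i := U i `&` V i.
have Wo i : open (W i) by exact: openI.
have WK i : W i `<=` K i by move=> x [_ /VK].
have satW i x : saturation act (W i) x <-> U i x.
  split=> [[g [/Ui//]]|Ux]; have [g Vgx] := UV i x Ux.
  by exists g; split=> //; apply/Ui.
(* The caps [1/(i+1)] make the [p i] continuous at each point uniformly in [i]: beyond some index
   all values are small. *)
have c0 i : 0 < i.+1%:R^-1 :> R by rewrite invr_gt0.
have /choice[p pP] i : exists p : X -> R, [/\ forall x, 0 <= p x <= i.+1%:R^-1,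
    forall g x, p (act g x) = p x, forall x, 0 < p x <-> U i x &
    forall x e, 0 < e -> \forall y \near x, `|p y - p x| < e].
  have [p [p0 pact pW pc]] := invariant_bump lc proper (c0 i) (@Kc i) (@Ks i) (Wo i) (WK i).
  by exists p; split=> // x; rewrite pW satW.
have pge0 i x : 0 <= p i x by have [/(_ x)/andP[]] := pP i.
have ple i x : p i x <= i.+1%:R^-1 by have [/(_ x)/andP[]] := pP i.
have pact i g x : p i (act g x) = p i x by have [] := pP i.
have pU i x : 0 < p i x <-> U i x by have [] := pP i.
have p01 x i : 0 <= p i x <= 1.
  by rewrite pge0 (le_trans (ple i x))// invf_le1// ler1n.
have pequi x (e : R) : 0 < e -> \forall y \near x, forall i, `|p i y - p i x| <= e.
  move=> e0; pose N := Num.truncn e^-1.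
  have Nnear : \forall y \near x, forall i, `I_N i -> `|p i y - p i x| < e.
    by apply: finite_near (finite_II N) _ => i _; have [_ _ _] := pP i; exact.
  apply: filterS Nnear => y yN i; have [iN|Ni] := ltnP i N; first exact/ltW/yN.
  have ie : i.+1%:R^-1 <= e.
    rewrite -[leRHS]invrK lef_pV2 ?posrE ?invr_gt0//.
    by rewrite (le_trans (ltW (truncnS_gt _)))// ler_nat ltnS.
  have := pge0 i x; have := pge0 i y; have := le_trans (ple i x) ie.
  by have := le_trans (ple i y) ie; rewrite ler_norml; lra.
pose f x i := p i x.
have fact g x : f (act g x) = f x by apply/funext => i; exact: pact.
pose q l x := topgap l (f x).
have qc l : continuous (q l : X -> R).
  move=> x; apply/cvgrPdist_le => e e0.
  have e20 : 0 < e / 2 by rewrite divr_gt0.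
  apply: filterS (pequi x _ e20) => y xy.
  rewrite distrC; have -> : e = 2 * (e / 2) by lra.
  exact: topgap_perturb (p01 x) (p01 y) xy.
have q0 l x : 0 <= q l x by exact: topgap_ge0 (p01 x).
pose Q x := \sum_(l < n.+1) q l x.
(* If exactly [l.+1] of the [U i] contain [x], then [q l x > 0], and the order bound gives
   [l <= n]. *)
have Q0 x : 0 < Q x.
  have fS : finite_set [set i | U i x].
    apply: contrapT => /(infinite_set_fset n.+2)[S SU].
    by rewrite leqNgt ltnS (Un x)// => i /SU.
  pose S := fset_set [set i | U i x].
  have SU i : i \in S <-> U i x by rewrite in_fset_set// inE.
  have [i iU] := Uc x.
  have S0 : (0 < #|` S|)%N by rewrite cardfs_gt0; apply/fset0Pn; exists i; apply/SU.
  have Sn : (#|` S|.-1 < n.+1)%N.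
    by rewrite prednK// (Un x)// => j /SU.
  rewrite /Q (bigD1 (Ordinal Sn))//= ltr_pwDl//; last exact: sumr_ge0.
  apply: (topgap_support (S := S) (p01 x)); first by rewrite prednK.
  by move=> j; rewrite SU.
(* The dominating family is chosen from the sequence [f x] alone, hence is constant along orbits. *)
have /choice[S SP] (lf : nat * (nat -> R)) : exists S : {fset nat},
    0 < topgap lf.1 lf.2 -> exists2 t, 0 < t & gap lf.2 lf.1 t S.
  have [/topgap_gt0[t t0 [S g]]|] := pselect (0 < topgap lf.1 lf.2).
    by exists S => _; exists t.
  by move=> nq; exists fset0 => /nq.
have /choice[e eP] (A : {fset nat}) : exists i, (0 < #|` A|)%N -> i \in A.
  have [->|[i iA]] := fset_0Vmem A; first by exists 0%N; rewrite cardfs0.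
  by exists i.
pose idx l x := e (S (l, f x)).
have idxU l x : 0 < q l x -> U (idx l x) x.
  move=> ql; have [t t0 [Sl fS]] := SP (l, f x) ql.
  have iS : idx l x \in S (l, f x) by apply: eP; rewrite Sl.
  have [j jS] := fset_infinite (S (l, f x)).
  apply/pU; have := fS _ _ iS jS; rewrite /f/=.
  by have := pge0 j x; lra.
(* For [x] in [U i] the element carrying [x] into [V i] is unique, by [Vuniq]; its inverse depends
   equivariantly on [x]. *)
have /choice[c cP] (ix : nat * X) : exists g, U ix.1 ix.2 -> V ix.1 (act g ix.2).
  have [/UV[g Vg]|nU] := pselect (U ix.1 ix.2); first by exists g.
  by exists 1%g => /nU.
have Vuniq i g h x : V i (act g x) -> V i (act h x) -> g = h.
  move=> /VK Kg /VK Kh.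
  have hg : (h * g^-1)%g = 1%g by apply: Ks Kg _; rewrite -tactM divgK.
  by rewrite -(divgK g h) hg mul1g.
pose k (l : 'I_n.+1) x := Num.sqrt (q l x / Q x).
have k0 l x : k l x != 0 -> 0 < q l x.
  by rewrite /k sqrtr_eq0 -ltNge pmulr_lgt0// invr_gt0.
have Qact g x : Q (act g x) = Q x by rewrite /Q /q fact.
have Qc : continuous (Q : X -> R).
  by apply: continuous_sum => l; exact: qc.
exists k, (fun l x => (c (idx l x, x))^-1%g); split.
- move=> l x; split; first exact: sqrtr_ge0.
  rewrite (eq_bigr (fun l' : 'I_n.+1 => q l' x / Q x)) => [|l' _].
    by rewrite -mulr_suml -/(Q x) divff// gt_eqF// Q0.
  by rewrite sqr_sqrtr// divr_ge0// ltW.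
- move=> l x; apply: continuous_comp; last exact: sqrt_continuous.
  by apply: cvgM; [exact: qc|apply: cvgV; [rewrite gt_eqF|exact: Qc]].
- by move=> l g x; rewrite /k Qact /q fact.
- move=> l x /k0 ql g; rewrite /idx fact -/(idx l x).
  set i := idx l x; have Uix : U i x by exact: idxU.
  have Vx := cP (i, x) Uix; have /= Vgx := cP (i, act g x) ((Ui i g x).2 Uix).
  rewrite -[g in RHS]invgK -invgM; congr (_^-1)%g.
  apply: (Vuniq i _ _ (act g x)) => //.
  by rewrite tactM -(tactM act g^-1%g) mulVg tact1.
move=> l x /k0 ql; set i := idx l x; have Uix : U i x by exact: idxU.
have Vx := cP (i, x) Uix.
have qnear : \forall y \near x, 0 < q l y.
  by apply: (cvgr_gt (q l x)) => //; exact: qc.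
have Vnear : \forall y \near x, V i (act (c (i, x)) y).
  apply: (@tact_continuous _ _ act (c (i, x)) x).
  by apply: open_nbhs_nbhs; split.
have Unear : \forall y \near x, U i y by apply: open_nbhs_nbhs; split.
have [t t0 gS] := SP (nat_of_ord l, f x) ql.
have Snear : \forall y \near x, S (nat_of_ord l, f y) = S (nat_of_ord l, f x).
  (* A perturbation by [t / 4] leaves the gap [t / 2 > 0], and a positive gap determines the
     family. *)
  have t40 : 0 < t / 4 by rewrite divr_gt0.
  apply: filterS2 qnear (pequi x _ t40) => y qy xy.
  have [t' t'0 gS'] := SP (nat_of_ord l, f y) qy.
  apply: gap_uniq t'0 _ gS' (gap_perturb (e := t / 4) xy gS); lra.
apply: filterS3 Snear Vnear Unear => y Sy Vy Uy.
have iy : idx l y = i by rewrite /idx Sy.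
rewrite iy; congr (_^-1)%g; apply: (Vuniq i _ _ y) => //.
exact: (cP (i, y)).
Qed.

End Towers.

(** * A compactly supported approximate unit *)

Lemma compact_approximate_unit (R : realType) (X : metricType R)
    (K V : nat -> set X) :
  (forall i, compact (K i)) -> (forall i, open (V i)) ->
  (forall i, V i `<=` K i) -> (forall x, exists i, V i x) ->
  exists u : nat -> X -> R, [/\ forall m x, 0 <= u m x <= 1,
    forall m, continuous (u m),
    forall m, exists2 C, compact C & forall x, ~ C x -> u m x = 0 &
    forall C, compact C -> \forall m \near \oo, forall x, C x -> u m x = 1].
Proof.
move=> Kc Vo VK Vc; pose b i := bump 1 (V i).
have b0 i x : 0 <= b i x by exact: bump_ge0.
have bc i : continuous (b i : X -> R).
  move=> x; apply/cvgrPdist_lt => e /(bump_continuous (V i) ltr01 x).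
  by apply: filterS => y; rewrite distrC.
(* The sum is supported in the first [m] sets [K i]; the factor [m] drives the minimum up to [1] on
   compact sets. *)
exists (fun m x => Num.min 1 (m%:R * \sum_(i < m) b i x)); split.
- move=> m x; rewrite le_min ler01 ge_min lexx/= andbT.
  by rewrite mulr_ge0// sumr_ge0.
- move=> m x; apply: (@continuous_min _ _ (fun=> 1) (fun x => m%:R * \sum_(i < m) b i x)).
    exact: cvg_cst.
  apply: cvgM; first exact: cvg_cst.
  by apply: continuous_sum => i; exact: bc.
- move=> m; exists (\big[setU/set0]_(i < m) K i).
    by apply: bigsetU_compact => i _; exact: (@Kc i).
  move=> x nKx; rewrite big1 ?mulr0 ?min_r// => i _.
  by apply: bump_eq0 => // /VK Kx; apply: nKx; rewrite -bigcup_mkord; exists i => /=.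
move=> C /compact_near_coveringP Cc; apply: Cc => x _.
have [i Vx] := Vc x; have bx : 0 < b i x by exact: bump_gt0.
(* For [m >= N] the [i]-th term occurs in the sum, and [m > 2 / b i x] offsets
   [b i y > b i x / 2]. *)
pose N := maxn i.+1 (Num.truncn (2 / b i x)).+1.
exists ([set y | b i x / 2 < b i y], [set m | (N <= m)%N]).
  split; last by exists N.
  by apply: (cvgr_gt (b i x)); [exact: bc|lra].
case=> y m [/= yb]; rewrite geq_max => /andP[im Nm].
apply/min_idPl; rewrite (bigD1 (Ordinal im))//=.
apply: le_trans (_ : m%:R * b i y <= _); last first.
  by rewrite ler_wpM2l// lerDl sumr_ge0.
have m2 : 2 / b i x < m%:R by rewrite (lt_le_trans (truncnS_gt _))// ler_nat.
apply: le_trans (_ : (2 / b i x) * (b i x / 2) <= _).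
  by rewrite mulrA divfK ?gt_eqF// divff.
by apply: ler_pM; rewrite ?divr_ge0// ltW.
Qed.

(** * Central sequences of commutative algebras *)

Section CommutativeCentral.
Context {R : realType} {A : cstarAlgType R} (D : starSubalg A).
Hypothesis smulC : forall a b : A, a ⋆ b = b ⋆ a.
Implicit Types f g : linfty nat A.

(** By commutativity the relative commutant is all of [Ainf A], so [Fcentral D] is a quotient of the
    algebra of bounded sequences. *)
Fact commutant_qpi f : subalg_set (commutant D) (qpi (c0 A) f).
Proof.
by move=> d _; rewrite /cst_embed -!qpiM; congr qpi; apply: linftyP => n; exact: smulC.
Qed.

Definition central_class f : Fcentral D :=
  qpi (ann D) (subalg_of (commutant D) (commutant_qpi f)).

Lemma central_class_surj (q : Fcentral D) : exists f, q = central_class f.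
Proof.
exists (qrepr (subalg_val (qrepr q))); rewrite -[LHS]qreprK; congr qpi.
by apply: val_inj; rewrite /= qreprK.
Qed.

Lemma central_classD f g :
  central_class (f + g) = central_class f + central_class g.
Proof.
rewrite /central_class -qpiD; congr qpi; apply: val_inj; exact: qpiD.
Qed.

Lemma central_classZ (a : R[i]) f :
  central_class (a *: f) = a *: central_class f.
Proof.
rewrite /central_class -qpiZ; congr qpi; apply: val_inj; exact: qpiZ.
Qed.

Lemma central_classM f g :
  central_class (f ⋆ g) = central_class f ⋆ central_class g.
Proof.
rewrite /central_class -qpiM; congr qpi; apply: val_inj; exact: qpiM.
Qed.

Lemma central_class_star f : central_class (star f) = star (central_class f).
Proof.
rewrite /central_class [RHS]qpi_star; congr qpi; apply: val_inj.
by rewrite /= -[RHS]/(qstar _) qpi_star.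
Qed.

Lemma central_class0 : central_class 0 = 0.
Proof. by apply: (addrI (central_class 0)); rewrite -central_classD !addr0. Qed.

Lemma rnorm_central_class f : rnorm (central_class f) <= rnorm f.
Proof.
by rewrite rnorm_quotE (le_trans (quot_norm_le _ _))// (quot_norm_le (c0 A)).
Qed.

Lemma central_class_eq f g : (forall d, subalg_set D d -> forall e : R, 0 < e ->
    \forall n \near \oo, rnorm ((f n - g n) ⋆ d) < e) ->
  central_class f = central_class g.
Proof.
move=> fg; apply/qpiP/annP => d Dd /=.
transitivity (qpi (c0 A) ((f - g) ⋆ const_seq d)).
  rewrite qpiM; congr (_ ⋆ _).
  by rewrite -[_ - qpi _ g]/(_ + _) -scaleN1r -qpiZ -qpiD scaleN1r.
by rewrite -(qpi0 (c0 A)); apply/qpiP; rewrite subr0; apply/c0P; exact: fg.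
Qed.

Lemma central_class_act (G : groupType) (alpha : cstarAction G A)
    (Dinv : Defs.invariant alpha D) (t : G) f :
  Fcentral_act Dinv t (central_class f) = central_class (seq_act alpha t f).
Proof.
rewrite [LHS]Fcentral_act_pi; congr qpi; apply: val_inj; exact: Ainf_act_pi.
Qed.

End CommutativeCentral.

(** * Weighted functions on cosets *)

Section CosetWeights.
Context {R : realType} {G : groupType} (H : set G) {X : metricType R}.
Local Open Scope complex_scope.
Local Notation A := (subalg (C0 R X)).

Fact coset_of_subproof (g : G) : lcoset g H \in lcosets H.
Proof. by apply/mem_set; exists g. Qed.

Definition coset_of (g : G) : lcosets H := exist _ (lcoset g H) (coset_of_subproof g).

Lemma lcosets_act_coset_of t g : lcosets_act t (coset_of g) = coset_of (t * g)%g.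
Proof.
apply: val_inj => /=; apply/seteqP; split=> [_ [_ [h Hh <-] <-]|_ [h Hh <-]].
  by exists h => //; rewrite mulgA.
by exists (g * h)%g; [exists h|rewrite mulgA].
Qed.

Lemma rnorm_scale_real (c : R) (z : cplx R) : 0 <= c ->
  rnorm (c%:C *: z) = c * rnorm z.
Proof.
move=> c0; rewrite rnormZ; congr (_ * _).
by rewrite /rnorm ger0_norm ?ler0c.
Qed.

(** These conditions put [w x * f (s x H)], as a function of [x], in [C0 R X]; [s] has to be locally
    constant only where [w] does not vanish. *)
Definition coset_weight (s : X -> G) (w : X -> R) : Prop :=
  [/\ forall x, 0 <= w x <= 1, continuous w,
      exists2 C, compact C & forall x, ~ C x -> w x = 0 &
      forall x, w x != 0 -> \forall y \near x, s y = s x].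

Lemma coset_weight_map s w : coset_weight s w ->
  exists a : Ccosets R H -> A, forall (f : Ccosets R H) x,
    subalg_val (a f) x = (w x)%:C *: f (coset_of (s x)).
Proof.
move=> [w01 wc [C cC wC] ws].
suff /choice[a aP] (f : Ccosets R H) : exists a : A, forall x,
    subalg_val a x = (w x)%:C *: f (coset_of (s x)) by exists a.
pose F x : cplx R := (w x)%:C *: f (coset_of (s x)).
have Fle x : rnorm (F x) <= w x * rnorm f.
  have /andP[w0 _] := w01 x.
  by rewrite rnorm_scale_real// ler_wpM2l// sup_norm_ge.
have Fb : F \in bounded_pred.
  apply/asboolP; exists (rnorm f) => x; apply: le_trans (Fle x) _.
  by have /andP[_ w1] := w01 x; rewrite ler_piMl// rnorm_ge0.
suff Fin : subalg_set (C0 R X) (Linfty Fb) by exists (subalg_of (C0 R X) Fin).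
split=> [x|e e0]; last first.
  by exists C => // x /wC wx; rewrite /= /F wx scale0r rnorm0.
apply/cvgrPdist_lt => _ /gt0_complexP[e e0 ->].
have f1 : 0 < rnorm f + 1 by rewrite ltr_wpDl// rnorm_ge0.
(* At a zero of [w] the bound [Fle] gives continuity whatever [s] does; elsewhere [s] is locally
   constant. *)
have [wx|wx] := eqVneq (w x) 0.
  have d0 : 0 < e / (rnorm f + 1) by rewrite divr_gt0.
  have /cvgrPdist_lt/(_ _ d0) := wc x; apply: filterS => y.
  rewrite wx sub0r normrN rnorm_lt /= /F wx scale0r sub0r rnormN.
  rewrite ltr_pdivlMr// => wy; apply: le_lt_trans (Fle y) _.
  have /andP[wy0 _] := w01 y; move: wy; rewrite ger0_norm//.
  by apply: le_lt_trans; rewrite ler_wpM2l// lerDl.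
have d0 : 0 < e / (rnorm f + 1) by rewrite divr_gt0.
have /cvgrPdist_lt/(_ _ d0) := wc x; apply: filterS2 (ws x wx) => y sy wxy.
rewrite rnorm_lt /= /F sy -scalerBl -rmorphB rnormZ.
have -> : rnorm ((w x - w y)%:C : R[i]^o) = `|w x - w y|.
  by rewrite /rnorm normc_def/= expr0n/= addr0 sqrtr_sqr.
move: wxy; rewrite ltr_pdivlMr//; apply: le_lt_trans.
by rewrite ler_wpM2l// (le_trans (sup_norm_ge f _))// lerDl.
Qed.

Lemma coset_weight_seq s (w : nat -> X -> R) : (forall n, coset_weight s (w n)) ->
  exists rho : Ccosets R H -> linfty nat A, forall (f : Ccosets R H) n x,
    subalg_val (rho f n) x = (w n x)%:C *: f (coset_of (s x)).
Proof.
move=> ws; have /choice[a aP] n := coset_weight_map (ws n).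
suff ab (f : Ccosets R H) : (fun n => a n f) \in bounded_pred.
  by exists (fun f : Ccosets R H => Linfty (ab f)) => f n x; exact: aP.
apply/asboolP; exists (rnorm f) => n; apply: sup_norm_le => [|x].
  exact: rnorm_ge0.
have [/(_ x)/andP[w0 w1] _ _ _] := ws n.
rewrite aP rnorm_scale_real// (le_trans (ler_wpM2l w0 (sup_norm_ge f _)))//.
by rewrite ler_piMl// sup_norm_ge0.
Qed.

End CosetWeights.

(** * Central sequences of functions vanishing at infinity *)

Section C0Central.
Context {R : realType} {X : metricType R}.
Local Open Scope complex_scope.
Local Notation A := (subalg (C0 R X)).

Lemma C0_smulC (a b : A) : a ⋆ b = b ⋆ a.
Proof. by apply: C0P => x; exact: mulrC. Qed.

Section Evaluation.
Implicit Types (f g : linfty nat A) (m : nat) (x : X).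

Lemma C0_seqP f g :
  (forall m x, subalg_val (f m) x = subalg_val (g m) x) -> f = g.
Proof. by move=> fg; apply: linftyP => m; apply: C0P => x; exact: fg. Qed.

Lemma C0_seqD f g m x :
  subalg_val ((f + g) m) x = subalg_val (f m) x + subalg_val (g m) x.
Proof. by rewrite linftyDE subalg_valD linftyDE. Qed.

Lemma C0_seqZ (a : R[i]) f m x :
  subalg_val ((a *: f) m) x = a *: subalg_val (f m) x.
Proof. by rewrite linftyZE subalg_valZ linftyZE. Qed.

Lemma C0_seqM f g m x :
  subalg_val ((f ⋆ g) m) x = subalg_val (f m) x ⋆ subalg_val (g m) x.
Proof. by rewrite linftyME subalg_valM linftyME. Qed.

Lemma C0_seq_star f m x :
  subalg_val ((star f) m) x = star (subalg_val (f m) x).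
Proof. by rewrite linfty_starE subalg_val_star linfty_starE. Qed.

Lemma C0_seq0 m x : subalg_val ((0 : linfty nat A) m) x = 0.
Proof. by []. Qed.

Lemma C0_seq_sum (I : finType) (F : I -> linfty nat A) m x :
  subalg_val ((\sum_i F i) m) x = \sum_i subalg_val (F i m) x.
Proof.
apply: (big_morph (fun f : linfty nat A => subalg_val (f m) x)).
  by move=> f g; exact: C0_seqD.
exact: C0_seq0.
Qed.

End Evaluation.

(** Off a large compact set [d] is small while [f - g] stays bounded; on that set the difference is
    eventually zero. *)
Lemma C0_central_class_eq (D : starSubalg A) (f g : linfty nat A) :
  (forall C : set X, compact C -> \forall n \near \oo, forall x, C x ->
    subalg_val (f n) x = subalg_val (g n) x) ->
  central_class D C0_smulC f = central_class D C0_smulC g.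
Proof.
move=> fg; apply: central_class_eq => d _ e e0.
have [_ dv] := subalg_valP d.
have M1 : 0 < rnorm (f - g) + 1 by rewrite ltr_wpDl// rnorm_ge0.
have e2M : 0 < e / 2 / (rnorm (f - g) + 1) by rewrite !divr_gt0.
have [C cC dC] := dv _ e2M.
apply: filterS (fg C cC) => n fgn.
apply: le_lt_trans (_ : e / 2 < e); last by rewrite ltr_pdivrMr// ltr_pMr// ltr1n.
apply: sup_norm_le => [|x]; first by rewrite divr_ge0// ltW.
have [Cx|/dC dx] := pselect (C x).
  have -> : subalg_val ((f n - g n) ⋆ d) x = 0.
    transitivity ((subalg_val (f n) x - subalg_val (g n) x) ⋆ subalg_val d x).
      by [].
    by rewrite fgn// subrr smul0l.
  by rewrite rnorm0 divr_ge0// ltW.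
apply: le_trans (_ : rnorm (subalg_val (f n - g n) x) * rnorm (subalg_val d x) <= _).
  by rewrite -lecR rmorphM/= !rnormK norm_smul.
move: dx; rewrite ltr_pdivlMr// mulrC => /ltW; apply: le_trans.
rewrite ler_wpM2r ?rnorm_ge0//.
apply: le_trans (_ : rnorm (f - g) <= _); last by rewrite lerDl.
apply: le_trans (sup_norm_ge (f - g) n).
exact: (sup_norm_ge (subalg_val (f n - g n)) x).
Qed.

End C0Central.

(** * The order zero maps *)

Lemma dim_rok_at_le_cov_dim (R : realType) (G : groupType) (X : metricType R)
    (act : topAction G X) (H : set G) (n : nat) :
  locally_compact [set: X] -> separable_set [set: X] ->
  free_action act -> proper_action act -> cov_dim_le X n ->
  dim_rok_at_le (C0_action act (R := R)) H n.
Proof.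
move=> lc sepX free proper dimX D Dinv _.
have [K [V [Kc Ks Vo VK Vc]]] := countable_slices lc proper free sepX.
have [k [s [kP kc kact sact sloc]]] := rokhlin_towers lc proper dimX Kc Ks Vo VK Vc.
have [u [u01 uc usupp u1]] := compact_approximate_unit Kc Vo VK Vc.
have k0 l x : 0 <= k l x by have [] := kP l x.
have k1 l x : k l x <= 1.
  have [_ sk] := kP l x; rewrite -(@expr_le1 _ 2)// -sk (bigD1 l)//= lerDl.
  by apply: sumr_ge0 => i _; exact: sqr_ge0.
have wP l m : coset_weight (s l) (fun x => u m x * k l x).
  split.
  - move=> x; have /andP[u0 ule] := u01 m x.
    by rewrite mulr_ge0//= mulr_ile1.
  - by move=> x; apply: cvgM; [exact: uc|exact: kc].
  - by have [C cC Cu] := usupp m; exists C => // x /Cu ->; rewrite mul0r.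
  - by move=> x; rewrite mulf_eq0 negb_or => /andP[_]; exact: sloc.
have w2P l m : coset_weight (s l) (fun x => (u m x * k l x) ^+ 2).
  have [w01 wc [C cC wC] ws] := wP l m; split.
  - by move=> x; have /andP[w0 w1] := w01 x; rewrite sqr_ge0 expr_le1.
  - by move=> x; apply: cvgM; exact: wc.
  - by exists C => // x /wC ->; rewrite expr0n.
  - by move=> x; rewrite sqrf_eq0; exact: ws.
have /choice[rho rhoE] l := coset_weight_seq H (w2P l).
have /choice[kap kapE] l := coset_weight_seq H (wP l).
pose cl := central_class D (@C0_smulC R X).
have rhoD l (a : R[i]) f g : rho l (a *: f + g) = a *: rho l f + rho l g.
  apply: C0_seqP => m x; rewrite C0_seqD C0_seqZ !rhoE linftyDE linftyZE.
  by rewrite scalerDr !scalerA mulrC.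
have rho_star l f : rho l (star f) = star (rho l f).
  by apply: C0_seqP => m x; rewrite C0_seq_star !rhoE linfty_starE starZ conjc_real.
have rho_sq l f g : rho l (star f ⋆ g) = star (kap l f) ⋆ kap l g.
  apply: C0_seqP => m x; rewrite C0_seqM C0_seq_star !kapE rhoE.
  by rewrite linftyME linfty_starE starZ conjc_real smulZl smulZr scalerA -rmorphM expr2.
have rho0 l f g : f ⋆ g = 0 -> rho l f ⋆ rho l g = 0.
  move=> fg0; apply: C0_seqP => m x; rewrite C0_seqM C0_seq0 !rhoE smulZl smulZr.
  by rewrite -(linftyME f g) fg0 !scaler0.
have cl_lin l : linear (fun f => cl (rho l f)).
  by move=> a f g; rewrite /cl rhoD central_classD central_classZ.
exists (fun l f => cl (rho l f)); split.
- move=> l; split=> // m M [N MN].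
  (* The weight of [kap l] is the square root of that of [rho l]. *)
  exists (\matrix_(i, j) cl (kap l (N i j))).
  apply/matrixP => i j; rewrite !mxE MN mxE.
  pose F : {linear Ccosets R H -> Fcentral D} :=
    HB.pack (fun f => cl (rho l f)) (GRing.isLinear.Build _ _ _ _ _ (cl_lin l)).
  rewrite -[LHS]/(F _) raddf_sum; apply: eq_bigr => t _.
  by rewrite !mxE /F/= rho_sq /cl central_classM central_class_star.
- move=> l f; rewrite -!rnormK lecR.
  apply: le_trans (rnorm_central_class _ _ _) _.
  apply: sup_norm_le => [|m]; first exact: rnorm_ge0.
  apply: sup_norm_le => [|x]; first exact: rnorm_ge0.
  have [/(_ x)/andP[w0 w1] _ _ _] := w2P l m.
  rewrite rhoE rnorm_scale_real//.
  by rewrite (le_trans (ler_wpM2l w0 (sup_norm_ge f _)))// ler_piMl// sup_norm_ge0.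
- move=> l f g [fg gf sfg sgf].
  by split; rewrite /cl -?central_class_star -?rho_star -central_classM rho0//
    central_class0.
- move=> l t f; rewrite /cl central_class_act.
  apply: C0_central_class_eq => C cC.
  (* [u m] need not be invariant; on this larger compact set it is eventually [1] at both [x] and
     [act t^-1 x], leaving the invariant weight [k l x ^+ 2]. *)
  have cCt : compact (C `|` act t^-1%g @` C).
    apply: compactU => //; apply: continuous_compact => //.
    by apply: continuous_subspaceT; exact: tact_continuous.
  apply: filterS (u1 _ cCt) => m um x Cx.
  rewrite rhoE.
  transitivity (subalg_val (rho l f m) (act t^-1%g x)); last by [].
  rewrite rhoE !um ?kact; [|by right; exists x|by left].
  (* Equivariance of [s l] is available only where [k l] is nonzero; elsewhere both sides vanish. *)
  have [->|kx] := eqVneq (k l x) 0; first by rewrite mulr0 expr0n !scale0r.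
  by rewrite sact// -lcosets_act_coset_of.
have unit_left q : (\sum_l cl (rho l (Ccosets1 R H))) ⋆ q = q.
  have [h ->] := central_class_surj (@C0_smulC R X) q.
  have -> : \sum_l cl (rho l (Ccosets1 R H)) = cl (\sum_l rho l (Ccosets1 R H)).
    apply: esym; apply: (big_morph cl) => [f g|]; first exact: central_classD.
    exact: central_class0.
  (* On a compact set where [u m] is [1], the weights sum to [\sum_l k l x ^+ 2 = 1]. *)
  rewrite /cl -central_classM; apply: C0_central_class_eq => C cC.
  apply: filterS (u1 _ cC) => m um x Cx.
  rewrite C0_seqM C0_seq_sum.
  have -> : \sum_l subalg_val (rho l (Ccosets1 R H) m) x = (1 : cplx R).
    rewrite (eq_bigr (fun l => ((k l x ^+ 2)%:C)%C *: (1 : cplx R))) => [|l _].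
      by rewrite -scaler_suml -rmorph_sum; have [_ ->] := kP ord0 x; rewrite scale1r.
    by rewrite rhoE um// mul1r.
  exact: mul1r.
move=> q; split=> //.
have [h qh] := central_class_surj (@C0_smulC R X) q.
have [h' qh'] := central_class_surj (@C0_smulC R X) (\sum_l cl (rho l (Ccosets1 R H))).
rewrite -[RHS]unit_left qh qh' -!central_classM; congr central_class.
by apply: linftyP => m; exact: C0_smulC.
Qed.

Theorem corollary4p6 (R : realType) (G : groupType) (X : metricType R)
    (act : topAction G X) :
  countable [set: G] ->
  amenable G R ->
  finitely_generated G ->
  residually_finite G ->
  locally_compact [set: X] ->
  separable_set [set: X] ->
  (cov_dim X R < +oo)%E ->
  free_action act ->
  proper_action act ->
  (dim_rok (C0_action act (R := R)) <= cov_dim X R)%E.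
Proof.
move=> _ _ _ _ lc sepX _ free proper.
(* Both sides being extrema, it suffices to bound [dim_rok_at] for each [H] by each [n] with
   [cov_dim_le X n]. *)
apply: le_ereal_inf_tmp => _ [n dimX <-].
apply: ge_ereal_sup => _ [H _ <-].
apply: ereal_inf_lbound; exists n => //.
exact: dim_rok_at_le_cov_dim.
Qed.
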